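(* Let $\mathcal{N}(t)$, $t>0$, be a classical nonlinear pure birth process with birth rates $\lambda_k>0$, $k\ge1$, and $\mathcal{N}(0)=1$. Let $n\in\mathbb{N}$, $n\ge1$, let $T^1_t,\dots,T^n_t$ be the first-passage times at level $t$ of $n$ independent standard Brownian motions, independent of $\mathcal{N}$, and let $\tilde p_k(t)$, $t>0$, $k\ge1$, be the distribution of $$\tilde{\mathcal{N}}(t)=\mathcal{N}\Bigl(T^1_{T^2_{\cdots_{T^n_t}}}\Bigr),\qquad t>0,$$ that is, $\tilde p_k(t)=\Pr\{\tilde{\mathcal{N}}(t)=k\}$. Then $$\frac{d^{2^n}}{dt^{2^n}}\tilde p_k(t)=2^{2^n-1}\left\{\lambda_k\tilde p_k(t)-\lambda_{k-1}\tilde p_{k-1}(t)\right\},\qquad k\ge1,\ t>0,$$ where $\tilde p_0\equiv0$.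
   Context: The nonlinear pure birth process $\mathcal{N}(t)$ with rates $(\lambda_k)_{k\ge1}$ is the continuous-time Markov chain on $\{1,2,\dots\}$ started at $1$ which from state $k$ jumps only to $k+1$, at rate $\lambda_k$; it is assumed throughout that $\sum_k1/\lambda_k=\infty$ (no explosion). For independent standard Brownian motions $B^1,\dots,B^n$, $T^j_x=\inf\{s:B^j(s)=x\}$, $x>0$; the iterated time is obtained by evaluating $T^n$ at $t$, then $T^{n-1}$ at the level $T^n_t$, and so on up to $T^1$. *)

(* Defs.v *)
From HB Require Import structures.
From mathcomp Require Import all_boot all_order all_algebra.
From mathcomp Require Import finmap.
From mathcomp Require Import all_classical all_reals all_analysis.

Set Implicit Arguments.
Unset Strict Implicit.
Unset Printing Implicit Defensive.

Import Order.TTheory GRing.Theory Num.Theory.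
Import numFieldNormedType.Exports.

Local Open Scope classical_set_scope.
Local Open Scope ring_scope.

(* Stochastic processes are functions R -> T -> E of which only the times
   t >= 0 are meaningful. *)

Definition process_sigma d (T : measurableType d) d' (E : measurableType d')
    (R : realType) (D : set R) (X : R -> T -> E) : set (set T) :=
  <<s [set A | exists t V, [/\ D t, measurable V & A = X t @^-1` V]] >>.

Definition mutual_independence d (T : measurableType d) (R : realType)
    (P : probability T R) (I : choiceType) (F : I -> set (set T)) : Prop :=
  forall (J : {fset I}) (A : I -> set T),
    (forall i, i \in J -> F i (A i)) ->
    P (\bigcap_(i in [set` J]) A i) = (\prod_(i <- J) P (A i))%E.

(* The second parameter of normal_prob is the standard deviation. *)
Record standard_brownian_motion d (T : measurableType d) (R : realType)
    (P : probability T R) (B : R -> T -> R) : Prop := {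
  bm_measurable : forall t : R, 0 <= t -> measurable_fun setT (B t);
  bm_start : forall w, B 0 w = 0;
  bm_continuous : forall w,
    {within `[0, +oo[%classic, continuous (fun t => B t w)};
  bm_gaussian : forall (s t : R) (V : set R), 0 <= s -> s < t -> measurable V ->
    P [set w | V (B t w - B s w)] = normal_prob 0 (Num.sqrt (t - s)) V;
  bm_indep_increments : forall (s t : R) (A : set T) (V : set R),
    0 <= s -> s < t -> process_sigma `[0, s]%classic B A -> measurable V ->
    P (A `&` [set w | V (B t w - B s w)]) =
    (P A * P [set w | V (B t w - B s w)%R])%E }.

(* p h i j is the probability of being in j at time s + h given i at time s
   and the past before s.  The product form leaves p h i j unconstrained when
   state i is never visited, and determines it otherwise. *)
Definition homogeneous_markov d (T : measurableType d) (R : realType)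
    (P : probability T R) (N : R -> T -> nat) (p : R -> nat -> nat -> R) :
    Prop :=
  forall (s h : R) (i j : nat) (A : set T), 0 <= s -> 0 <= h ->
    process_sigma `[0, s]%classic N A ->
    P (A `&` [set w | N s w = i] `&` [set w | N (s + h) w = j]) =
    (P (A `&` [set w | N s w = i]) * (p h i j)%:E)%E.

(* The two limits say that, from i, the process stays with probability
   1 - lambda i * h + o(h) and moves to i + 1 with probability
   lambda i * h + o(h), so that any other move has probability o(h). *)
Record pure_birth_process d (T : measurableType d) (R : realType)
    (P : probability T R) (lambda : nat -> R) (N : R -> T -> nat) : Prop := {
  pb_measurable : forall t : R, 0 <= t -> measurable_fun setT (N t);
  pb_start : forall w, N 0 w = 1%N;
  pb_nondecreasing : forall w (s t : R), 0 <= s -> s <= t -> (N s w <= N t w)%N;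
  pb_right_continuous : forall w (t : R), 0 <= t ->
    \forall s \near t^'+, N s w = N t w;
  pb_markov : exists2 p : R -> nat -> nat -> R,
    homogeneous_markov P N p &
    forall i, (1 <= i)%N ->
      (fun h => p h i i.+1 / h) @ 0^'+ --> lambda i /\
      (fun h => (1 - p h i i) / h) @ 0^'+ --> lambda i }.

(* inf set0 = 0, but a Brownian path almost surely reaches every level. *)
Definition first_passage (T : Type) (R : realType) (B : R -> T -> R)
    (x : R) (w : T) : R :=
  inf [set s | 0 <= s /\ B s w = x].

(* The head of enum 'I_n is applied last: B ord0 plays the role of B^1. *)
Definition iterated_passage (T : Type) (R : realType) (n : nat)
    (B : 'I_n -> R -> T -> R) (t : R) (w : T) : R :=
  foldr (fun j x => first_passage (B j) x w) t (enum 'I_n).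

Definition iterated_birth (T : Type) (R : realType) (n : nat)
    (B : 'I_n -> R -> T -> R) (N : R -> T -> nat) (t : R) (w : T) : nat :=
  N (iterated_passage B t w) w.

Definition state_prob d (T : measurableType d) (R : realType)
    (P : probability T R) (X : R -> T -> nat) (k : nat) (t : R) : R :=
  if k is 0%N then 0 else fine (P [set w | X t w = k]).

Definition joint_sigma d (T : measurableType d) (R : realType) (n : nat)
    (B : 'I_n -> R -> T -> R) (N : R -> T -> nat) (i : option 'I_n) :
    set (set T) :=
  if i is Some j then process_sigma `[0, +oo[%classic (B j)
  else process_sigma `[0, +oo[%classic N.

(* Main.v *)
(* Write f~(t) for the expectation of f at the iterated passage time started
   from level t.  For one Brownian motion the exponential martingale gives
   E exp(- (q^2/2) T_x) = exp(- q x), and differentiating in q gives the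
   moments E (T_x^m exp(- (q^2/2) T_x)); hence A f (x) := E f(T_x) maps the
   span of the functions s^m exp(- mu s) to itself and satisfies
   D^2 A = - 2 A D there.  Iterating n times,
   D^(2^n) A^n = - 2^(2^n - 1) A^n D.  The Kolmogorov forward equations put the
   state probabilities p_k of the birth process in that span (multiplicities
   m > 0 occur when rates coincide), with
   D p_k = - lambda_k p_k + lambda_(k-1) p_(k-1), and independence gives
   p~_k = A^n p_k, whence the claim. *)

From HB Require Import structures.
Require Import Defs.
From mathcomp Require Import all_boot all_order all_algebra.
From mathcomp Require Import finmap.
From mathcomp Require Import ring lra.
From mathcomp Require Import all_classical all_reals all_analysis.
From mathcomp Require Import measurable_realfun.
Set Implicit Arguments.
Unset Strict Implicit.
Unset Printing Implicit Defensive.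
Import Order.TTheory GRing.Theory Num.Theory.
Import numFieldNormedType.Exports.
Local Open Scope classical_set_scope.
Local Open Scope ring_scope.

(** * Exponential polynomials and their passage transform *)

(** Three obstacles shape the proof. Brownian motion is given through its increments, so optional
    stopping is carried out in discrete time, on a grid capped by a horizon [K]; refining the grid
    and letting [K] grow gives the Laplace transform, and [theta] tending to 0 shows that every
    level is almost surely reached. A process is evaluated at an independent random time by
    discretising that time; passage times are left-continuous in the level and birth paths
    right-continuous, which decides from which side the time is approximated. Finally, the birth
    process is specified by right-hand limits of transition probabilities at 0. The state
    probabilities are therefore not differentiated: a solution of the forward equation is built in
    the span, and an Euler scheme identifies it with the state probability, because the forward
    increments are controlled uniformly in time. The constant comes from a recursion: if
    [A^n D = c_n D^(2^n) A^n], then one more transform gives [c_(n+1) = - c_n^2 / 2], with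
    [c_0 = 1]. *)

Section exponential_polynomials.
Context {R : realType}.
Implicit Types (f g F G : R -> R) (m : nat) (mu q c x s : R).

Definition exppoly m mu s : R := s ^+ m * expR (- mu * s).

(** Rates are positive, so that members are bounded on the half-line and the expectations below
    exist. *)
Inductive exppoly_span : (R -> R) -> Prop :=
| Exppoly_span0 : exppoly_span (fun=> 0)
| Exppoly_spanD c m mu f : 0 < mu -> exppoly_span f ->
    exppoly_span (fun s => c * exppoly m mu s + f s).

Lemma exppoly_spanZ c f : exppoly_span f -> exppoly_span (fun s => c * f s).
Proof.
elim=> [|c' m mu g mu0 _ IH].
  rewrite (_ : (fun=> _) = (fun=> 0)); first exact: Exppoly_span0.
  by apply/funext => s; rewrite mulr0.
rewrite (_ : (fun s => _) = (fun s => c * c' * exppoly m mu s + c * g s)).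
  exact: Exppoly_spanD.
by apply/funext => s; ring.
Qed.

Lemma exppoly_span_add f g : exppoly_span f -> exppoly_span g ->
  exppoly_span (fun s => f s + g s).
Proof.
move=> Vf Vg; elim: Vf => [|c m mu h mu0 _ IH].
  by rewrite (_ : (fun s => _) = g)//; apply/funext => s; rewrite add0r.
rewrite (_ : (fun s => _) = (fun s => c * exppoly m mu s + (h s + g s))).
  exact: Exppoly_spanD.
by apply/funext => s; ring.
Qed.

Lemma exppoly_span_exppoly m mu : 0 < mu -> exppoly_span (exppoly m mu).
Proof.
move=> mu0; rewrite (_ : exppoly m mu = (fun s => 1 * exppoly m mu s + 0)).
  by apply: Exppoly_spanD => //; exact: Exppoly_span0.
by apply/funext => s; ring.
Qed.

Lemma exppoly_spanX f : exppoly_span f -> exppoly_span (fun s => s * f s).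
Proof.
elim=> [|c m mu g mu0 _ IH].
  rewrite (_ : (fun=> _) = (fun=> 0)); first exact: Exppoly_span0.
  by apply/funext => s; rewrite mulr0.
rewrite (_ : (fun s => _) = (fun s => c * exppoly m.+1 mu s + s * g s)).
  exact: Exppoly_spanD.
by apply/funext => s; rewrite /exppoly exprS; ring.
Qed.

(* The library states these rules for functions such as [f + g], which do not
   unify with the pointwise lambdas below. *)
Lemma is_derive_lamD (f g : R -> R) a b s : is_derive s 1 f a -> is_derive s 1 g b ->
  is_derive s 1 (fun s => f s + g s) (a + b).
Proof. by move=> fa gb; exact: is_deriveD. Qed.

Lemma is_derive_lamM (f g : R -> R) a b s : is_derive s 1 f a -> is_derive s 1 g b ->
  is_derive s 1 (fun s => f s * g s) (a * g s + f s * b).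
Proof.
move=> fa gb; rewrite (_ : (fun s => _) = f * g)//.
by apply: is_derive_eq; rewrite /GRing.scale/= addrC mulrC.
Qed.

Lemma is_derive_lamXn m s : is_derive s 1 (fun s : R => s ^+ m) (m%:R * s ^+ m.-1).
Proof.
elim: m => [|m IH]; first by rewrite mul0r; exact: is_derive_cst.
rewrite (_ : (fun s => _) = (fun s => id s * s ^+ m)); last by apply/funext => r; rewrite exprS.
apply: (is_derive_eq (is_derive_lamM (is_derive_id s 1) IH)).
case: m {IH} => [|m]; rewrite ?exprS -?natr1/=; ring.
Qed.

Lemma is_derive_lamZ (f : R -> R) c a s : is_derive s 1 f a ->
  is_derive s 1 (fun s => c * f s) (c * a).
Proof. by move=> fa; exact: is_deriveZ. Qed.
Lemma is_derive_expRMr a s : is_derive s 1 (fun s : R => expR (a * s)) (a * expR (a * s)).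
Proof.
apply: (is_derive_eq (is_derive1_comp (is_derive_expR _) (is_derive_lamZ a (is_derive_id s 1)))).
by rewrite mulr1 mulrC.
Qed.

Lemma is_derive_exppoly m mu s : is_derive s 1 (exppoly m mu)
  (m%:R * exppoly m.-1 mu s - mu * exppoly m mu s).
Proof.
apply: (is_derive_eq (is_derive_lamM (is_derive_lamXn m s) (is_derive_expRMr (-mu) s))).
rewrite /exppoly; ring.
Qed.

(* [passage_moment m q x] is (- d/dmu)^m exp(- q x) with q = sqrt(2 mu), given by
   the Bessel recurrence. *)
Fixpoint passage_moment m q x : R :=
  if m is m1.+1 then
    if m1 is m2.+1 then
      ((m2.*2.+1)%:R * passage_moment m1 q x + x ^+ 2 * passage_moment m2 q x) / q ^+ 2
    else x / q * expR (- q * x)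
  else expR (- q * x).

Lemma passage_momentSS m q x : passage_moment m.+2 q x =
  ((m.*2.+1)%:R * passage_moment m.+1 q x + x ^+ 2 * passage_moment m q x) / q ^+ 2.
Proof. by []. Qed.

Lemma nat_ind2 (Q : nat -> Prop) : Q 0%N -> Q 1%N ->
  (forall m, Q m -> Q m.+1 -> Q m.+2) -> forall m, Q m.
Proof.
move=> Q0 Q1 QS m; suff [] : Q m /\ Q m.+1 by [].
by elim: m => // m [Qm QSm]; split=> //; exact: QS.
Qed.

Lemma is_derive_expRMl a s : is_derive s 1 (fun s : R => expR (- s * a)) (- a * expR (- s * a)).
Proof.
rewrite (_ : (fun s => _) = (fun s => expR (- a * s))); last by apply/funext => r; rewrite !mulNr mulrC.
apply: (is_derive_eq (is_derive_expRMr (- a) s)).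
by congr (_ * expR _); ring.
Qed.

Lemma is_derive_lamV (f : R -> R) a s : f s != 0 -> is_derive s 1 f a ->
  is_derive s 1 (fun s => (f s)^-1) (- (f s) ^- 2 * a).
Proof. by move=> fs fa; exact: is_deriveV. Qed.

(** As [mu = q ^+ 2 / 2], d/dq is q d/dmu: this confirms that the recurrence produces the iterates
    of - d/dmu. Being three-term, it calls for induction in steps of two. *)
Lemma is_derive_passage_moment_rate m q x : 0 < q ->
  is_derive q 1 (fun q => passage_moment m q x) (- q * passage_moment m.+1 q x).
Proof.
move=> q0; have qN0 : q != 0 by rewrite gt_eqF.
elim/nat_ind2: m.
- apply: (is_derive_eq (is_derive_expRMl x q)) => /=; by field.
- have qV := is_derive_lamV qN0 (is_derive_id q 1).
  apply: (is_derive_eq (is_derive_lamM (is_derive_lamZ x qV) (is_derive_expRMl x q))).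
  rewrite passage_momentSS double0 /=; by field.
- move=> m IH0 IH1.
  have q2 : q ^+ 2 != 0 by rewrite expf_neq0.
  have qV := @is_derive_lamV (fun q => q ^+ 2) _ q q2 (is_derive_lamXn 2 q).
  apply: (is_derive_eq (is_derive_lamM (is_derive_lamD (is_derive_lamZ (m.*2.+1)%:R IH1)
    (is_derive_lamZ (x ^+ 2) IH0)) qV)).
  rewrite (passage_momentSS m.+1) (passage_momentSS m) /= doubleS.
  rewrite -!natr1; field.
  done.
Qed.

Lemma is_derive_passage_moment0 q x : 
  is_derive x 1 (passage_moment 0 q)
    (- q * passage_moment 0 q x).
Proof. exact: is_derive_expRMr. Qed.

(* [passage_moment m.+1 q x / x], defined without division so that derivatives
   make sense at [x = 0]. *)
Fixpoint passage_ratio m q x : R :=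
  if m is m1.+1 then
    ((m1.*2.+1)%:R * passage_ratio m1 q x + x * passage_moment m1 q x) / q ^+ 2
  else q^-1 * expR (- q * x).

Lemma passage_ratioS m q x : passage_ratio m.+1 q x =
  ((m.*2.+1)%:R * passage_ratio m q x + x * passage_moment m q x) / q ^+ 2.
Proof. by []. Qed.

Lemma passage_momentS m q x : passage_moment m.+1 q x = x * passage_ratio m q x.
Proof.
elim: m => [|m IH]; first by rewrite /= mulrA.
by rewrite passage_momentSS IH passage_ratioS; ring.
Qed.

(** The second claim follows from the first by [passage_momentS] and the product rule. The induction
    needs it in turn, since the ratio of index [m.+2] contains the moment of index [m.+1]. *)
Lemma is_derive_passage_ratio_moment m q x : q != 0 ->
  is_derive x 1 (passage_ratio m q) (- passage_moment m q x) /\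
  is_derive x 1 (passage_moment m.+1 q) (passage_ratio m q x - x * passage_moment m q x).
Proof.
move=> q0.
have momentE k y : passage_moment k.+1 q y = y * passage_ratio k q y by exact: passage_momentS.
have der k : is_derive x 1 (passage_ratio k q) (- passage_moment k q x) ->
  is_derive x 1 (passage_moment k.+1 q) (passage_ratio k q x - x * passage_moment k q x).
  move=> H; rewrite (_ : passage_moment k.+1 q = (fun y => y * passage_ratio k q y)); last exact/funext.
  by apply: (is_derive_eq (is_derive_lamM (is_derive_id x 1) H)); rewrite /=; ring.
suff H : is_derive x 1 (passage_ratio m q) (- passage_moment m q x) by split => //; exact: der.
elim/nat_ind2: m => [||m IH0 IH1].
- apply: (is_derive_eq (is_derive_lamZ q^-1 (is_derive_expRMr (- q) x))) => /=; by field.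
- have H0 := is_derive_lamZ q^-1 (is_derive_expRMr (- q) x).
  apply: (is_derive_eq (is_derive_lamM (is_derive_lamD (is_derive_lamZ 1%:R H0)
    (is_derive_lamM (is_derive_id x 1) (is_derive_passage_moment0 q x))) (is_derive_cst (q ^+ 2)^-1 x 1))).
  by rewrite /cst /=; field.
- apply: (is_derive_eq (is_derive_lamM (is_derive_lamD (is_derive_lamZ (m.+1.*2.+1)%:R IH1)
    (is_derive_lamM (is_derive_id x 1) (der m IH0))) (is_derive_cst (q ^+ 2)^-1 x 1))).
  rewrite (passage_momentSS m) /cst doubleS passage_momentS -!natr1; field.
  by [].
Qed.

Lemma derive_exppoly m mu : derive1 (exppoly m mu) =
  (fun s => m%:R * exppoly m.-1 mu s - mu * exppoly m mu s).
Proof.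
by apply/funext => s; rewrite derive1E; have [_ ->] := is_derive_exppoly m mu s.
Qed.

(** This is [D^2 A = - 2 A D] on the basis: compare with [derive_exppoly], [q ^+ 2] being twice the
    rate. At [m = 0] the predecessor is harmless, its coefficient being 0. *)
Lemma derive2_passage_moment m q : q != 0 -> derive1 (derive1 (passage_moment m q)) =
  (fun x => q ^+ 2 * passage_moment m q x - 2 * m%:R * passage_moment m.-1 q x).
Proof.
move=> q0.
have d0 : derive1 (passage_moment 0 q) = (fun x => - q * passage_moment 0 q x).
  by apply/funext => x; rewrite derive1E; have [_ ->] := is_derive_passage_moment0 q x.
have dS k : derive1 (passage_moment k.+1 q) = (fun x => passage_ratio k q x - x * passage_moment k q x).
  by apply/funext => x; rewrite derive1E; have [_ [_ ->]] := is_derive_passage_ratio_moment k x q0.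
case: m => [|m]; apply/funext => x.
  rewrite d0 derive1E; have [_ ->] := is_derive_lamZ (- q) (is_derive_passage_moment0 q x); ring.
rewrite dS derive1E.
have [H1 _] := is_derive_passage_ratio_moment m x q0.
have {H1}H1 dm H2 := is_derive_lamD H1 (is_derive_lamZ (-1) (is_derive_lamM (is_derive_id x 1) (H2 : is_derive x 1 _ dm))).
rewrite (_ : (fun x => _) = (fun s : R => passage_ratio m q s + -1 * (id s * passage_moment m q s))); last first.
  by apply/funext => y; rewrite mulN1r.
case: m H1 => [|m] H1.
  have [_ ->] := H1 _ _ (is_derive_passage_moment0 q x).
  by rewrite /=; field.
have [_ ->] := H1 _ _ (is_derive_passage_ratio_moment m x q0).2.
by rewrite -pred_Sn passage_momentSS passage_momentS -mul2n -!natr1 natrM; field.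
Qed.

Lemma exppoly_span_derivable f s : exppoly_span f -> derivable f s 1.
Proof.
move=> Vf; suff [df [d _]] : exists df, is_derive s 1 f df by [].
elim: Vf => [|c m mu g mu0 _ [dg Hg]]; first by exists 0; exact: is_derive_cst.
by eexists; exact: (is_derive_lamD (is_derive_lamZ c (is_derive_exppoly m mu s)) Hg).
Qed.

Lemma derive1_lamD (f g : R -> R) : (forall s, derivable f s 1) ->
  (forall s, derivable g s 1) ->
  derive1 (fun s => f s + g s) = (fun s => derive1 f s + derive1 g s).
Proof.
by move=> df dg; apply/funext => s; rewrite !derive1E deriveD.
Qed.

Lemma derive1_lamZ c (f : R -> R) : (forall s, derivable f s 1) ->
  derive1 (fun s => c * f s) = (fun s => c * derive1 f s).
Proof. by move=> df; apply/funext => s; rewrite !derive1E deriveZ. Qed.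

Lemma exppoly_span_derive f : exppoly_span f -> exppoly_span (derive1 f).
Proof.
elim=> [|c m mu g mu0 Vg IH].
  by rewrite (_ : derive1 _ = (fun=> 0)); [exact: Exppoly_span0|apply/funext => s; rewrite derive1_cst].
rewrite derive1_lamD; last by move=> s; exact: exppoly_span_derivable.
  apply: exppoly_span_add => //; rewrite derive1_lamZ.
    apply: exppoly_spanZ; rewrite derive_exppoly.
    apply: exppoly_span_add; first exact/exppoly_spanZ/exppoly_span_exppoly.
    rewrite (_ : (fun=> _) = (fun s => - mu * exppoly m mu s)).
      exact/exppoly_spanZ/exppoly_span_exppoly.
    by apply/funext => s; rewrite mulNr.
  by move=> s; have [] := is_derive_exppoly m mu s.
by move=> s; apply: exppoly_span_derivable; apply/exppoly_spanZ/exppoly_span_exppoly.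
Qed.

Lemma exppoly_span_derive1n m f : exppoly_span f -> exppoly_span (derive1n m f).
Proof. by move=> Vf; elim: m => // m; rewrite derive1nS; exact: exppoly_span_derive. Qed.

Lemma derive1n_span_Z m c f : exppoly_span f ->
  derive1n m (fun s => c * f s) = (fun s => c * derive1n m f s).
Proof.
move=> Vf; elim: m => // m IH; rewrite derive1nS IH derive1_lamZ ?derive1nS// => s.
exact/exppoly_span_derivable/exppoly_span_derive1n.
Qed.

Lemma exppoly_span_passage_moment m q : 0 < q -> exppoly_span (passage_moment m q).
Proof.
move=> q0; elim/nat_ind2: m => [||m IH0 IH1].
- rewrite (_ : passage_moment _ _ = exppoly 0 q); first exact: exppoly_span_exppoly.
  by apply/funext => x; rewrite /exppoly/= mul1r.
- rewrite (_ : passage_moment _ _ = (fun x => q^-1 * exppoly 1 q x)).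
    exact/exppoly_spanZ/exppoly_span_exppoly.
  by apply/funext => x; rewrite /exppoly/=; ring.
rewrite (_ : passage_moment _ _ = (fun x => (q ^+ 2)^-1 *
   ((m.*2.+1)%:R * passage_moment m.+1 q x + x * (x * passage_moment m q x)))).
  apply/exppoly_spanZ/exppoly_span_add; first exact: exppoly_spanZ.
  by do 2 apply: exppoly_spanX.
by apply/funext => x; rewrite passage_momentSS; ring.
Qed.

(** A graph rather than a function: the image is read off a representation in the span, whose
    uniqueness would otherwise have to be proved. *)
Inductive passage_transform : (R -> R) -> (R -> R) -> Prop :=
| Passage_transform0 : passage_transform (fun=> 0) (fun=> 0)
| Passage_transformD c m q f F : 0 < q -> passage_transform f F ->
    passage_transform (fun s => c * exppoly m (q ^+ 2 / 2) s + f s)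
                      (fun x => c * passage_moment m q x + F x).

Lemma passage_transform_ex f : exppoly_span f -> exists F, passage_transform f F.
Proof.
elim=> [|c m mu g mu0 _ [G gG]]; first by exists (fun=> 0); exact: Passage_transform0.
have [q q0 ->] : exists2 q, 0 < q & mu = q ^+ 2 / 2.
  exists (Num.sqrt (2 * mu)); first by rewrite sqrtr_gt0 mulr_gt0.
  by rewrite sqr_sqrtr ?mulr_ge0 ?(ltW mu0)//; field.
by exists (fun x => c * passage_moment m q x + G x); exact: Passage_transformD.
Qed.

Lemma passage_transform_span f F : passage_transform f F -> exppoly_span f /\ exppoly_span F.
Proof.
elim=> [|c m q g G q0 _ [Vg VG]]; first by split; exact: Exppoly_span0.
split; first by apply: Exppoly_spanD; rewrite // divr_gt0 ?exprn_gt0.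
by apply: exppoly_span_add => //; exact/exppoly_spanZ/exppoly_span_passage_moment.
Qed.

Lemma passage_transformZ c f F : passage_transform f F ->
  passage_transform (fun s => c * f s) (fun x => c * F x).
Proof.
elim=> [|c' m q g G q0 _ IH].
  rewrite (_ : (fun=> _) = (fun=> 0)); first exact: Passage_transform0.
  by apply/funext => s; rewrite mulr0.
rewrite (_ : (fun s => _) = (fun s => c * c' * exppoly m (q ^+ 2 / 2) s + c * g s)); last first.
  by apply/funext => s; ring.
rewrite (_ : (fun x => c * _) = (fun x => c * c' * passage_moment m q x + c * G x)); last first.
  by apply/funext => s; ring.
exact: Passage_transformD.
Qed.

Lemma passage_transform_add f F g G : passage_transform f F -> passage_transform g G ->
  passage_transform (fun s => f s + g s) (fun x => F x + G x).
Proof.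
move=> fF gG; elim: fF => [|c m q h H q0 _ IH].
  rewrite (_ : (fun s => 0 + g s) = g); last by apply/funext => s; rewrite add0r.
  by rewrite (_ : (fun s => 0 + G s) = G); last by apply/funext => s; rewrite add0r.
rewrite (_ : (fun s => _ + g s) = (fun s => c * exppoly m (q ^+ 2 / 2) s + (h s + g s))); last first.
  by apply/funext => s; ring.
rewrite (_ : (fun x => _ + G x) = (fun x => c * passage_moment m q x + (H x + G x))); last first.
  by apply/funext => s; ring.
exact: Passage_transformD.
Qed.

Lemma passage_transform_exppoly m q : 0 < q ->
  passage_transform (exppoly m (q ^+ 2 / 2)) (passage_moment m q).
Proof.
move=> q0; rewrite (_ : exppoly _ _ = (fun s => 1 * exppoly m (q ^+ 2 / 2) s + 0)).
  rewrite (_ : passage_moment m q = (fun x => 1 * passage_moment m q x + 0)).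
    by apply: Passage_transformD => //; exact: Passage_transform0.
  by apply/funext => s; ring.
by apply/funext => s; ring.
Qed.

Lemma passage_transform_derive f F : passage_transform f F ->
  passage_transform (derive1 f) (fun x => - 2^-1 * derive1n 2 F x).
Proof.
elim=> [|c m q g G q0 gG IH].
  rewrite (_ : derive1 _ = (fun=> 0)); last by apply/funext => s; rewrite derive1_cst.
  rewrite (_ : (fun x => _) = (fun=> 0)); first exact: Passage_transform0.
  apply/funext => x; rewrite 2!derive1nS (_ : derive1 (derive1n 0 _) = (fun=> 0)).
    by rewrite derive1_cst mulr0.
  by apply/funext => s; rewrite derive1_cst.
have [Vg VG] := passage_transform_span gG.
have Vu := exppoly_span_passage_moment m q0.
have dE s : derivable (exppoly m (q ^+ 2 / 2)) s 1.
  by have [] := is_derive_exppoly m (q ^+ 2 / 2) s.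
have du s : derivable (passage_moment m q) s 1 by exact: exppoly_span_derivable.
have du' s : derivable (derive1 (passage_moment m q)) s 1.
  exact/exppoly_span_derivable/exppoly_span_derive.
have PT k := passage_transform_exppoly k q0.
(* The image of the derivative is assembled from [derive_exppoly]; what remains is to recognise
   [derive2_passage_moment] in it. *)
have := passage_transform_add (passage_transformZ c (passage_transform_add
  (passage_transformZ m%:R (PT m.-1)) (passage_transformZ (- (q ^+ 2 / 2)) (PT m)))) IH.
congr passage_transform.
  rewrite (@derive1_lamD (fun s => c * exppoly m (q ^+ 2 / 2) s) g).
  - rewrite (derive1_lamZ c dE) derive_exppoly.
    by apply/funext => s; rewrite mulNr.
  - by move=> s; exact: derivableZ.
  - by move=> s; exact: exppoly_span_derivable.
apply/funext => x; rewrite 4!derive1nS.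
rewrite (@derive1_lamD (fun s => c * passage_moment m q s) G).
- rewrite (derive1_lamZ c du).
  rewrite (@derive1_lamD (fun s => c * derive1 (passage_moment m q) s) (derive1 G)).
  + by rewrite (derive1_lamZ c du') derive2_passage_moment ?gt_eqF//=; field.
  + by move=> s; exact: derivableZ.
  + by move=> s; exact/exppoly_span_derivable/exppoly_span_derive.
- by move=> s; exact: derivableZ.
- by move=> s; exact: exppoly_span_derivable.
Qed.

(** The transform applied first to [f] integrates out the outermost passage time, the head of the
    list of motions. *)
Fixpoint iter_passage_transform n f F : Prop :=
  if n is n1.+1 then exists2 G, passage_transform f G & iter_passage_transform n1 G F
  else exppoly_span f /\ F = f.

Lemma iter_passage_transform_ex n f : exppoly_span f -> exists F, iter_passage_transform n f F.
Proof.
elim: n f => [|n IH] f Vf; first by exists f.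
have [G fG] := passage_transform_ex Vf.
by have [F GF] := IH G (passage_transform_span fG).2; exists F; exists G.
Qed.

Lemma iter_passage_transform_span n f F : iter_passage_transform n f F -> exppoly_span F.
Proof. by elim: n f => [f [Vf ->]//|n IH f [G _ /IH]]. Qed.

Lemma iter_passage_transformZ n c f F : iter_passage_transform n f F ->
  iter_passage_transform n (fun s => c * f s) (fun x => c * F x).
Proof.
elim: n f => [f [Vf ->]|n IH f [G fG GF]]; first by split=> //; exact: exppoly_spanZ.
by exists (fun x => c * G x); [exact: passage_transformZ|exact: IH].
Qed.

(** The constant [c_n] of [A^n D = c_n D^(2^n) A^n]. *)
Fixpoint passage_rate n : R := if n is n1.+1 then - 2^-1 * passage_rate n1 ^+ 2 else 1.

(** Each step doubles the exponent of 1/2 and adds one, whence 2^n - 1; squaring erases the sign and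
    the factor - 1/2 restores it. The initial value 1 has the other sign, hence [1 <= n]. *)
Lemma passage_rateE n : (1 <= n)%N -> passage_rate n = - (2 ^- (2 ^ n - 1)).
Proof.
elim: n => // -[|n] IH _; first by rewrite /= expr1n mulr1 expn1 subSS subn0 expr1.
rewrite [LHS]/= -/(passage_rate n.+1) IH// sqrrN -!exprVn -!exprM mulNr -exprS.
congr (- _); congr (_ ^+ _).
have [k kE] : exists k, (2 ^ n.+1 = k.+1)%N by exists (2 ^ n.+1).-1; rewrite prednK ?expn_gt0.
by rewrite (expnS 2 n.+1) kE !subn1 [k.+1.-1]/= (mulnS 2) add2n mulnC.
Qed.

Lemma iter_passage_transform_derive n f F : iter_passage_transform n f F ->
  iter_passage_transform n (derive1 f) (fun x => passage_rate n * derive1n (2 ^ n) F x).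
Proof.
elim: n f F => [f F [Vf ->]|n IH f F [G fG GF]].
  by split; [exact: exppoly_span_derive|apply/funext => s; rewrite mul1r derive1nS].
exists (fun x => - 2^-1 * derive1n 2 G x); first exact: passage_transform_derive.
have VF := iter_passage_transform_span GF.
(* Two derivatives of [G] are to be carried through, so the induction hypothesis is used twice: the
   constant is squared and the order doubled. *)
have /IH := IH _ _ GF.
rewrite derive1n_span_Z; last exact: exppoly_span_derive1n.
move=> /(iter_passage_transformZ (- 2^-1)).
congr (iter_passage_transform n _ _).
apply/funext => x /=; rewrite -/(passage_rate n).
rewrite /derive1n -iterD addnn -mul2n -expnS; ring.
Qed.

End exponential_polynomials.

(** * Bounds, linear differential equations and Taylor estimates in the span *)

Section exppoly_more.
Context {R : realType}.
Implicit Types (f g F G : R -> R) (m : nat) (mu q c x s h lam C : R).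

Lemma exppoly_span_continuous f : exppoly_span f -> continuous f.
Proof.
move=> Vf s; apply: differentiable_continuous; apply/derivable1_diffP.
exact: exppoly_span_derivable.
Qed.

Lemma exppoly_ge0 m mu s : 0 <= s -> 0 <= exppoly m mu s.
Proof. by move=> s0; rewrite mulr_ge0 ?exprn_ge0 ?expR_ge0. Qed.

(** With [y = mu * s / m.+1], the function is the bound times [(y exp(- y))^m exp(- y)], and both
    factors are at most 1. Taking [m.+1] instead of [m] covers [m = 0]. *)
Lemma exppoly_le m mu s : 0 < mu -> 0 <= s ->
  exppoly m mu s <= (m.+1%:R / mu) ^+ m.
Proof.
move=> mu0 s0; rewrite /exppoly; pose y := mu * s / m.+1%:R.
have y0 : 0 <= y by rewrite divr_ge0 ?mulr_ge0 ?(ltW mu0).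
have muN0 : mu != 0 by rewrite gt_eqF.
have -> : - mu * s = m.+1%:R * (- y).
  by rewrite /y; field; rewrite ?natr1 ?nat1r pnatr_eq0.
have {1}-> : s = m.+1%:R / mu * y.
  by rewrite /y; field; rewrite ?natr1 ?nat1r muN0 pnatr_eq0.
rewrite expRM_natl exprMn -mulrA -[leRHS]mulr1 ler_wpM2l ?exprn_ge0 ?divr_ge0 ?(ltW mu0)//.
rewrite exprS mulrCA -exprMn mulr_ile1 ?expR_ge0 ?exprn_ge0 ?mulr_ge0 ?expR_ge0 ?(ltW mu0)//.
  by rewrite -expR0 ler_expR oppr_le0.
rewrite exprn_ile1 ?mulr_ge0 ?expR_ge0 ?(ltW mu0)//.
rewrite expRN ler_pdivrMr ?expR_gt0// mul1r.
by apply: le_trans (expR_ge1Dx y); rewrite lerDr.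
Qed.

Lemma exppoly_span_bounded f : exppoly_span f ->
  exists2 C : R, 0 <= C & forall s, 0 <= s -> `|f s| <= C.
Proof.
elim=> [|c m mu g mu0 _ [C C0 Cg]]; first by exists 0 => // s; rewrite normr0.
exists (`|c| * (m.+1%:R / mu) ^+ m + C).
  by rewrite addr_ge0 ?mulr_ge0 ?exprn_ge0 ?divr_ge0 ?(ltW mu0).
move=> s s0; apply: (le_trans (ler_normD _ _)); rewrite lerD ?Cg// normrM.
by rewrite ler_wpM2l// ger0_norm ?exppoly_ge0 ?exppoly_le.
Qed.

(** Undetermined coefficients: a source of rate [lam] is resonant and raises the power of s by one;
    any other rate is handled by induction on the power. *)
Lemma exppoly_span_solve lam f : 0 < lam -> exppoly_span f ->
  exists2 v, exppoly_span v & derive1 v = (fun s => - lam * v s + f s).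
Proof.
move=> lam0.
have dV g s : exppoly_span g -> derivable g s 1 by exact: exppoly_span_derivable.
elim=> [|c m mu g mu0 Vg [w Vw dw]].
  exists (fun=> 0); first exact: Exppoly_span0.
  by apply/funext => s; rewrite derive1_cst mulr0 addr0.
suff [v Vv dv] : exists2 v, exppoly_span v & derive1 v = (fun s => - lam * v s + exppoly m mu s).
  exists (fun s => c * v s + w s).
    by apply: exppoly_span_add => //; exact: exppoly_spanZ.
  rewrite derive1_lamD; last by move=> s; exact: dV.
    rewrite derive1_lamZ; last by move=> s; exact: dV.
    by apply/funext => s; rewrite dv dw; ring.
  by move=> s; apply/dV; exact: exppoly_spanZ.
have [<-|muL] := eqVneq mu lam.
  exists (fun s => m.+1%:R^-1 * exppoly m.+1 mu s).
    exact/exppoly_spanZ/exppoly_span_exppoly.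
  rewrite derive1_lamZ; last by move=> s; exact/dV/exppoly_span_exppoly.
  rewrite derive_exppoly; apply/funext => s /=; rewrite -natr1; field.
  by rewrite natr1 pnatr_eq0.
elim: m => [|m [w' Vw' dw']].
  exists (fun s => (lam - mu)^-1 * exppoly 0 mu s).
    exact/exppoly_spanZ/exppoly_span_exppoly.
  rewrite derive1_lamZ; last by move=> s; exact/dV/exppoly_span_exppoly.
  rewrite derive_exppoly; apply/funext => s /=; field.
  by rewrite subr_eq0 eq_sym.
exists (fun s => (lam - mu)^-1 * exppoly m.+1 mu s + - (m.+1%:R / (lam - mu)) * w' s).
  by apply: exppoly_span_add; apply: exppoly_spanZ => //; exact: exppoly_span_exppoly.
rewrite derive1_lamD; last 2 first.
- by move=> s; exact/dV/exppoly_spanZ/exppoly_span_exppoly.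
- by move=> s; exact/dV/exppoly_spanZ.
rewrite !derive1_lamZ; last 2 first.
- by move=> s; exact/dV.
- by move=> s; exact/dV/exppoly_span_exppoly.
rewrite derive_exppoly dw'; apply/funext => s /=; rewrite -natr1; field.
by rewrite subr_eq0 eq_sym.
Qed.

Lemma exppoly_span_cauchy lam c f : 0 < lam -> exppoly_span f ->
  exists v, [/\ exppoly_span v, v 0 = c & derive1 v = (fun s => - lam * v s + f s)].
Proof.
move=> lam0 Vf; have [w Vw dw] := exppoly_span_solve lam0 Vf.
have dV g s : exppoly_span g -> derivable g s 1 by exact: exppoly_span_derivable.
have Ve := exppoly_span_exppoly 0 lam0.
exists (fun s => (c - w 0) * exppoly 0 lam s + w s); split.
- by apply: exppoly_span_add => //; exact: exppoly_spanZ.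
- by rewrite /exppoly expr0 mulr0 expR0; ring.
- rewrite derive1_lamD; last by move=> s; exact: dV.
    rewrite derive1_lamZ; last by move=> s; exact: dV.
    by rewrite derive_exppoly dw; apply/funext => s /=; ring.
  by move=> s; apply/dV; exact: exppoly_spanZ.
Qed.

(** Two uses of the mean value theorem; [C] bounds the second derivative on the half-line, so the
    estimate is uniform in [s], as the Euler scheme requires. *)
Lemma exppoly_span_taylor v : exppoly_span v -> exists2 C : R, 0 <= C &
  forall s h : R, 0 <= s -> 0 < h -> `|v (s + h) - v s - h * derive1 v s| <= C * h ^+ 2.
Proof.
move=> Vv; have [C C0 HC] := exppoly_span_bounded (exppoly_span_derive (exppoly_span_derive Vv)).
have mvt g (s h : R) : exppoly_span g -> 0 <= s -> 0 < h ->
    exists2 xi, s < xi < s + h & g (s + h) - g s = derive1 g xi * h.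
  move=> Vg s0 h0.
  have [|||xi] := @MVT R g (derive1 g) s (s + h); first by rewrite ltrDl.
  - by move=> x _; rewrite derive1E; exact/derivableP/exppoly_span_derivable.
  - exact/continuous_subspaceT/exppoly_span_continuous.
  rewrite in_itv/= => xis ->; exists xi => //; by congr (_ * _); ring.
exists C => // s h s0 h0.
have [xi /andP[sxi xih] ->] := mvt v s h Vv s0 h0.
have h'0 : 0 < xi - s by rewrite subr_gt0.
have [eta /andP[seta _]] := mvt _ s _ (exppoly_span_derive Vv) s0 h'0.
rewrite (addrC s) subrK => E.
rewrite (_ : _ - _ = (derive1 v xi - derive1 v s) * h); last by ring.
rewrite E !normrM (gtr0_norm h'0) (gtr0_norm h0) expr2 mulrA.
rewrite ler_wpM2r ?(ltW h0)// ler_pM// ?(ltW h'0)//.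
  by rewrite HC// (le_trans s0)// ltW.
by rewrite lerBlDl ltW.
Qed.

End exppoly_more.
(** Divide [[0, t]] into steps of length [h]. Once [h <= lam^-1], the factor [1 - lam * h] lies in
    [0, 1] and amplifies nothing, so the errors, each at most [eps / t * h], add up to at most
    [eps]. Forward increments are enough for this. *)
Lemma euler_uniqueness {R : realType} (e : R -> R) (lam : R) : 0 < lam -> e 0 = 0 ->
  (forall eps : R, 0 < eps -> \forall h \near 0^'+, forall s : R, 0 <= s ->
     `|e (s + h) - (1 - lam * h) * e s| <= eps * h) ->
  forall t : R, 0 <= t -> e t = 0.
Proof.
move=> lam0 e0 He t; rewrite le_eqVlt => /predU1P[<-//|t0].
apply/eqP; rewrite -normr_le0; apply/ler_addgt0Pr => eps eps0; rewrite add0r.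
have epst : 0 < eps / t by rewrite divr_gt0.
have lamV : 0 < lam^-1 by rewrite invr_gt0.
have [d /= d0 Hd] : \forall h \near 0^'+, (forall s, 0 <= s ->
     `|e (s + h) - (1 - lam * h) * e s| <= eps / t * h) /\ h <= lam^-1.
  near=> h; split; last by near: h; exact: nbhs_right_le.
  by near: h; exact: He.
pose n := (Num.truncn (t / d)).+1.
have n0 : 0 < n%:R :> R by rewrite ltr0n.
pose h := t / n%:R.
have h0 : 0 < h by rewrite divr_gt0.
have hd : h < d.
  rewrite /h ltr_pdivrMr// mulrC -ltr_pdivrMr//.
  by rewrite truncnS_gt.
have [|{}Hd hlam] := Hd h _ h0.
  by rewrite /= sub0r normrN gtr0_norm.
suff H k : `|e (k%:R * h)| <= k%:R * (eps / t * h).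
  have := H n; rewrite /h mulrCA divff ?gt_eqF// mulr1.
  move=> /le_trans; apply; rewrite le_eqVlt; apply/orP; left; apply/eqP.
  by field; rewrite (gt_eqF n0) (gt_eqF t0).
elim: k => [|k IH]; first by rewrite !mul0r e0 normr0.
rewrite -natr1 !mulrDl !mul1r.
have kh : 0 <= k%:R * h by rewrite mulr_ge0// ltW.
rewrite -[X in `|X|](subrK ((1 - lam * h) * e (k%:R * h))) [leRHS]addrC.
apply: (le_trans (ler_normD _ _)); rewrite lerD ?Hd// (le_trans _ IH)//.
rewrite normrM ler_piMl//.
have lh : lam * h <= 1 by rewrite mulrC -ler_pdivlMr// div1r.
rewrite ger0_norm ?subr_ge0// lerBlDr lerDl mulr_ge0 ?(ltW h0)// ltW//.
Unshelve. all: by end_near. Qed.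

(** * The birth process *)

Section birth_process.
Context d (T : measurableType d) (R : realType) (P : probability T R).
Variables (lambda : nat -> R) (N : R -> T -> nat).
Hypothesis lambda_gt0 : forall k, (1 <= k)%N -> 0 < lambda k.
Hypothesis birthN : pure_birth_process P lambda N.
Implicit Types (s h t eps : R) (i j k : nat).

Let p k s := state_prob P N k s.

Lemma birth_measurable s k : 0 <= s -> measurable [set w | N s w = k].
Proof.
move=> s0; have := pb_measurable birthN s0 measurableT (Y := [set k]).
by rewrite setTI; apply.
Qed.

Lemma birth_probE k s : 0 <= s -> (p k s)%:E = P [set w | N s w = k].
Proof.
move=> s0; rewrite /p; case: k => [|k] /=; last first.
  by rewrite fineK// fin_num_measure//; exact: birth_measurable.
rewrite (_ : [set w | _] = set0) ?measure0//.
apply/seteqP; split => // w /= Nsw.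
by have := pb_nondecreasing birthN w (lexx 0) s0; rewrite Nsw (pb_start birthN).
Qed.

Lemma birth_prob_ge0 k s : 0 <= s -> 0 <= p k s.
Proof. by move=> s0; rewrite -lee_fin birth_probE. Qed.

Lemma birth_prob_le1 k s : 0 <= s -> p k s <= 1.
Proof.
by move=> s0; rewrite -lee_fin birth_probE//; apply: probability_le1; exact: birth_measurable.
Qed.

Section transition.
Variable q : R -> nat -> nat -> R.
Hypothesis markovN : homogeneous_markov P N q.

Lemma birth_jointE s h i k : 0 <= s -> 0 <= h ->
  P ([set w | N s w = i] `&` [set w | N (s + h) w = k]) = (p i s * q h i k)%:E.
Proof.
move=> s0 h0; have := @markovN s h i k setT s0 h0.
rewrite !setTI => ->; first by rewrite EFinM birth_probE.
exact: (@measurableT _ (g_sigma_algebraType _)).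
Qed.

(** Paths are nondecreasing, so a path in [k] at time [s + h] was in a state at most [k] at time
    [s]: the sum is finite. *)
Lemma birth_prob_step s h k : 0 <= s -> 0 <= h ->
  p k (s + h) = \sum_(i < k.+1) p i s * q h i k.
Proof.
move=> s0 h0; have sh0 : 0 <= s + h by rewrite addr_ge0.
apply: EFin_inj; rewrite birth_probE// -sumEFin.
under eq_bigr do rewrite -birth_jointE//.
pose A i := [set w | N s w = i] `&` [set w | N (s + h) w = k].
transitivity (P (\big[setU/set0]_(i < k.+1) A i)); last first.
  apply: measure_bigsetU.
    by move=> i; apply: measurableI; exact: birth_measurable.
  by move=> i j _ _ [w [[/= <- _] [/= <- _]]].
congr (P _).
rewrite -bigcup_mkord; apply/seteqP; split => [w /= Nw|w [i _ []]//].
exists (N s w) => //=.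
by rewrite ltnS -Nw (pb_nondecreasing birthN)// lerDl.
Qed.

(** The kernel is known only through its product with [p i s], hence only at states of positive
    probability. *)
Lemma birth_trans_ge0 s h i k : 0 <= s -> 0 <= h -> 0 < p i s -> 0 <= q h i k.
Proof.
move=> s0 h0 pis; rewrite -(pmulr_rge0 _ pis) -lee_fin -birth_jointE//.
Qed.

Lemma birth_trans_le1 s h i k : 0 <= s -> 0 <= h -> 0 < p i s ->
  (i.+1 < k)%N -> q h i i + q h i i.+1 + q h i k <= 1.
Proof.
move=> s0 h0 pis ik; have sh0 : 0 <= s + h by rewrite addr_ge0.
rewrite -(ler_pM2l pis) mulr1 !mulrDr -lee_fin birth_probE// !EFinD -!birth_jointE//.
pose A j := [set w | N s w = i] `&` [set w | N (s + h) w = j].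
have mA j : measurable (A j) by apply: measurableI; exact: birth_measurable.
have A0 j l : j != l -> A j `&` A l = set0.
  move=> jl; apply/seteqP; split => // w [[_ /= jE] [_ /= lE]].
  by rewrite -jE -lE eqxx in jl.
have ii1 : i != i.+1 by rewrite neq_ltn ltnSn.
have ik' : i != k by rewrite neq_ltn (ltn_trans _ ik).
have i1k : i.+1 != k by rewrite neq_ltn ik.
rewrite -/(A i) -/(A i.+1) -/(A k) -measureU ?A0// -measureU//; last 2 first.
- exact: measurableU.
- by rewrite setIUl !A0// setU0.
apply: le_measure; rewrite ?inE//; first by do 2 apply: measurableU => //.
  exact: birth_measurable.
by move=> w [[[]|[]]|[]].
Qed.


(* From a visited state [i], every transition other than to [i] and [i.+1] has
   probability at most [1 - q h i i - q h i i.+1 = o(h)]; the estimate is therefore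
   uniform in the time [s]. *)
Lemma birth_forward_estimate k eps : (1 <= k)%N -> 0 < eps ->
  (forall i, (1 <= i)%N ->
      (fun h => q h i i.+1 / h) @ 0^'+ --> lambda i /\
      (fun h => (1 - q h i i) / h) @ 0^'+ --> lambda i) ->
  \forall h \near 0^'+, forall s, 0 <= s ->
   `|p k (s + h) - p k s - h * (- lambda k * p k s + lambda k.-1 * p k.-1 s)| <= eps * h.
Proof.
move=> k1 eps0 Hq; pose e := eps / (2 * k.+1%:R).
have e0 : 0 < e by rewrite divr_gt0// mulr_gt0// ltr0n.
have Hnear : \forall h \near 0^'+, forall i : 'I_k.+1, (1 <= i)%N ->
    `|q h i i.+1 / h - lambda i| < e /\ `|(1 - q h i i) / h - lambda i| < e.
  apply: filter_forall => -[[|i] ik]; first by near=> h.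
  have [H1 H2] := Hq i.+1 isT.
  move/cvgrPdist_lt : H1 => /(_ e e0) H1; move/cvgrPdist_lt : H2 => /(_ e e0) H2.
  near=> h => _; split; rewrite distrC/=; near: h; [exact: H1|exact: H2].
near=> h.
have h0 : 0 < h by near: h; exact: nbhs_right_gt.
have Hh : forall i : 'I_k.+1, (1 <= i)%N ->
    `|q h i i.+1 / h - lambda i| < e /\ `|(1 - q h i i) / h - lambda i| < e.
  by near: h.
have Hi i : (1 <= i <= k)%N -> `|q h i i.+1 - lambda i * h| <= e * h /\
    `|1 - q h i i - lambda i * h| <= e * h.
  move=> /andP[i1 ik].
  have [] : `|q h i i.+1 / h - lambda i| < e /\ `|(1 - q h i i) / h - lambda i| < e.
    have ik' : (i < k.+1)%N by rewrite ltnS.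
    exact: Hh (Ordinal ik') i1.
  have hN0 : h != 0 by rewrite gt_eqF.
  move=> H1 H2; split.
    rewrite -[X in X - _](divfK hN0) -mulrBl normrM (gtr0_norm h0).
    by rewrite ler_wpM2r ?(ltW h0) ?(ltW H1).
  rewrite -[X in X - _](divfK hN0) -mulrBl normrM (gtr0_norm h0).
  by rewrite ler_wpM2r ?(ltW h0) ?(ltW H2).
have e2h0 : 0 <= 2 * e * h by rewrite ltW// !mulr_gt0.
move=> s s0; rewrite birth_prob_step ?(ltW h0)//.
have term i : (i <= k)%N -> `|p i s * q h i k - (i == k)%:R * (p k s * (1 - lambda k * h))
    - (i.+1 == k)%:R * (h * (lambda k.-1 * p k.-1 s))| <= 2 * e * h.
  rewrite leq_eqVlt => /predU1P[->|].
    rewrite eqxx (gtn_eqF (ltnSn k)) mul1r mul0r subr0.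
    rewrite (_ : _ - _ = - (p k s * (1 - q h k k - lambda k * h))); last by ring.
    rewrite normrN normrM (ger0_norm (birth_prob_ge0 k s0)).
    rewrite (le_trans (ler_piMl _ (birth_prob_le1 k s0)))//.
    have [_ H] := Hi k (introT andP (conj k1 (leqnn k))).
    by rewrite (le_trans H)// ler_pM2r// ler_peMl ?(ltW e0)// ler1n.
  case: i => [_|i].
    rewrite (_ : p 0 s = 0)// mul0r eq_sym (gtn_eqF k1) mul0r subr0 sub0r normrN.
    case: eqP => [<-|_]; first by rewrite /= /p/= !mulr0 normr0.
    by rewrite mul0r normr0.
  move=> ik; rewrite (ltn_eqF ik) mul0r subr0.
  (* At a state of probability 0 the kernel is arbitrary, but the product vanishes. *)
  have := birth_prob_ge0 i.+1 s0; rewrite le_eqVlt => /predU1P[pi0|pi0].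
    rewrite -pi0 mul0r; case: eqP => [<-|_].
      by rewrite -pi0 !mulr0 subr0 normr0.
    by rewrite mul0r subr0 normr0.
  have [H1 H2] := Hi i.+1 (introT andP (conj isT (ltnW ik))).
  case: eqP => [ik'|/eqP ik'].
    rewrite -ik' -pred_Sn mul1r (_ : _ - _ = p i.+1 s * (q h i.+1 i.+2 - lambda i.+1 * h)); last by ring.
    rewrite normrM (ger0_norm (birth_prob_ge0 _ s0)).
    rewrite (le_trans (ler_piMl _ (birth_prob_le1 _ s0)))//.
    by rewrite (le_trans H1)// ler_pM2r// ler_peMl ?(ltW e0)// ler1n.
  rewrite mul0r subr0 normrM (ger0_norm (birth_prob_ge0 _ s0)).
  rewrite (le_trans (ler_piMl _ (birth_prob_le1 _ s0)))//.
  have ik2 : (i.+2 < k)%N by rewrite ltn_neqAle ik' ik.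
  rewrite ger0_norm ?(birth_trans_ge0 k s0 (ltW h0) pi0)//.
  (* The two terms [lambda i.+1 * h] cancel in 1 minus the probabilities of staying and of moving
     one step, which leaves [2 * e * h]. *)
  have := birth_trans_le1 s0 (ltW h0) pi0 ik2.
  by move: H1 H2; rewrite !ler_norml => /andP[? ?] /andP[? ?]; lra.
have {}term := fun i : 'I_k.+1 => term i (ltn_ord i).
rewrite (_ : _ - _ - _ = \sum_(i < k.+1) (p i s * q h i k
    - (i == k :> nat)%:R * (p k s * (1 - lambda k * h))
    - (i.+1 == k)%:R * (h * (lambda k.-1 * p k.-1 s)))); last first.
  rewrite !sumrB -!mulr_suml -!natr_sum.
  have -> : (\sum_(i < k.+1) (i == k :> nat) = 1)%N.
    rewrite (bigD1 ord_max)//= eqxx big1 ?addn0// => i.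
    by rewrite -val_eqE/= => /negbTE ->.
  have -> : (\sum_(i < k.+1) (i.+1 == k) = 1)%N.
    have kk : (k.-1 < k.+1)%N by rewrite ltnS leq_pred.
    rewrite (bigD1 (Ordinal kk))//= prednK// eqxx big1 ?addn0// => i.
    rewrite -val_eqE/= => ik; case: eqP => // ik'.
    by move: ik; rewrite -eqSS prednK// ik' eqxx.
  by rewrite mulr1n; ring.
apply: (le_trans (ler_norm_sum _ _ _)).
apply: (@le_trans _ _ (\sum_(i < k.+1) 2 * e * h)); first by apply: ler_sum => i _; exact: term.
rewrite sumr_const card_ord -mulr_natl /e le_eqVlt; apply/orP; left; apply/eqP; field.
by rewrite nat1r pnatr_eq0.
Unshelve. all: by end_near. Qed.

End transition.

(** The candidate [v'] solves the forward equation in the span with source [v] and initial value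
    [p k 0]. Its difference with [p k] satisfies the homogeneous Euler estimate and starts at 0, so
    it vanishes. *)
Lemma birth_prob_exppoly k v : (1 <= k)%N -> exppoly_span v ->
  (forall s, 0 <= s -> p k.-1 s = v s) ->
  exists2 v', exppoly_span v' /\ (forall s, 0 <= s -> p k s = v' s) &
    derive1 v' = (fun s => - lambda k * v' s + lambda k.-1 * v s).
Proof.
move=> k1 Vv pv; have [q markovN Hq] := pb_markov birthN.
have [v' [Vv' v'0 dv']] := exppoly_span_cauchy (p k 0) (lambda_gt0 k1) (exppoly_spanZ (lambda k.-1) Vv).
exists v' => //; split => // s s0; apply/eqP; rewrite -subr_eq0; apply/eqP.
apply: (@euler_uniqueness R (fun s => p k s - v' s) (lambda k)) => //; first exact: lambda_gt0.
  by rewrite v'0 subrr.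
move=> eps eps0; have eps2 : 0 < eps / 2 by rewrite divr_gt0.
have [C C0 HC] := exppoly_span_taylor Vv'.
(* Threshold on [h] that keeps the Taylor error below [eps / 2 * h]; [C + 1] avoids a division by
   zero. *)
have epsC : 0 < eps / 2 / (C + 1) by rewrite divr_gt0// ltr_wpDl.
near=> h => t t0.
have h0 : 0 < h by near: h; exact: nbhs_right_gt.
have H1 : forall s, 0 <= s ->
   `|p k (s + h) - p k s - h * (- lambda k * p k s + lambda k.-1 * p k.-1 s)| <= eps / 2 * h.
  by near: h; exact: (birth_forward_estimate markovN k1 eps2 Hq).
have H2 : C * h ^+ 2 <= eps / 2 * h.
  rewrite expr2 mulrA ler_pM2r// (@le_trans _ _ ((C + 1) * h))//.
    by rewrite ler_pM2r// lerDl.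
  by rewrite mulrC -ler_pdivlMr ?ltr_wpDl//; near: h; exact: nbhs_right_le.
have := le_trans (HC t h t0 h0) H2; have := H1 t t0.
rewrite dv' pv//.
rewrite !ler_norml => /andP[? ?] /andP[? ?]; lra.
Unshelve. all: by end_near. Qed.

End birth_process.

(** * Expectations and independence *)

Section probability_tools.
Context d (T : measurableType d) (R : realType) (P : probability T R).
Implicit Types (X Y : T -> R).

Lemma bounded_cvg_expectation (f_ : nat -> T -> R) (f : T -> R) (C : R) :
  (forall n, measurable_fun setT (f_ n)) -> measurable_fun setT f ->
  {ae P, forall w, f_ ^~ w @ \oo --> f w} ->
  (forall n w, `|f_ n w| <= C) ->
  (\int[P]_w (f_ n w)%:E)%E @[n --> \oo] --> (\int[P]_w (f w)%:E)%E.
Proof.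
move=> mf_ mf f_f f_C.
have [| | |_ _] := @dominated_convergence _ T R P setT measurableT
  (fun n w => (f_ n w)%:E) (fun w => (f w)%:E) (cst C%:E)
  (fun n => (measurable_EFinP _ _).2 (mf_ n)) ((measurable_EFinP _ _).2 mf) _ _ _.
- apply: filterS f_f => w f_fw _; apply: cvg_EFin; [exact: nearW|exact: f_fw].
- exact: finite_measure_integrable_cst.
- by apply: aeW => w n _ /=; rewrite lee_fin.
- exact.
Qed.

(** Equality on rectangles identifies the joint law with the product of the marginals; Tonelli does
    the rest. *)
Lemma ge0_expectationM X Y : measurable_fun setT X -> measurable_fun setT Y ->
  (forall w, 0 <= X w) -> (forall w, 0 <= Y w) ->
  (forall U V, measurable U -> measurable V ->
    P (X @^-1` U `&` Y @^-1` V) = (P (X @^-1` U) * P (Y @^-1` V))%E) ->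
  (\int[P]_w (X w * Y w)%:E = \int[P]_w (X w)%:E * \int[P]_w (Y w)%:E)%E.
Proof.
move=> mX mY X0 Y0 indepXY.
pose XX : {mfun T >-> R} := HB.pack X (isMeasurableFun.Build _ _ _ _ _ mX).
pose YY : {mfun T >-> R} := HB.pack Y (isMeasurableFun.Build _ _ _ _ _ mY).
have mXY : measurable_fun setT (fun w => (X w, Y w)).
  exact/measurable_fun_pair.
pose XY : {mfun T >-> (R * R)%type} := HB.pack (fun w => (X w, Y w)) (isMeasurableFun.Build _ _ _ _ _ mXY).
(* Truncation at 0 makes the integrand nonnegative on the whole plane and leaves it unchanged on the
   range of [(X, Y)]. *)
pose f (z : R * R) := (Num.max z.1 0 * Num.max z.2 0)%:E.
have mf : measurable_fun setT f.
  apply/measurable_EFinP; apply: measurable_funM; apply: measurable_maxr => //.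
have f0 z : (0 <= f z)%E by rewrite lee_fin mulr_ge0// le_max lexx orbT.
transitivity (\int[distribution P XY]_z f z)%E.
  rewrite ge0_integral_distribution//; apply: eq_integral => w _.
  by rewrite /f/= !max_l.
rewrite (eq_measure_integral (distribution P XX \x distribution P YY)%E); last first.
  move=> A mA _; apply/esym; exact: product_measure_unique.
rewrite fubini_tonelli1//=.

have mmax : measurable_fun setT (fun y : R => (Num.max y 0)%:E).
  by apply/measurable_EFinP; apply: measurable_maxr.
have max0 (y : R) : (0 <= (Num.max y 0)%:E)%E by rewrite lee_fin le_max lexx orbT.
have EY (Z : {mfun T >-> R}) : (forall w, 0 <= Z w) ->
    (\int[distribution P Z]_y (Num.max y 0)%:E = \int[P]_w (Z w)%:E)%E.
  move=> Z0; rewrite ge0_integral_distribution//.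
  by apply: eq_integral => w _ /=; rewrite max_l.
transitivity (\int[distribution P XX]_x ((Num.max x 0)%:E * \int[P]_w (Y w)%:E))%E.
  apply: eq_integral => x _; rewrite /fubini_F /f/=.
  under eq_integral do rewrite EFinM.
  by rewrite ge0_integralZl// (EY YY).
rewrite ge0_integralZr//; last by apply: integral_ge0 => w _; rewrite lee_fin.
by rewrite (EY XX).
Qed.

Lemma eq_expectation_preim_nat (K : T -> nat) (F G : T -> R) :
  (forall j, measurable [set w | K w = j]) ->
  measurable_fun setT F -> measurable_fun setT G ->
  (forall w, 0 <= F w) -> (forall w, 0 <= G w) ->
  (forall j, \int[P]_(w in [set w | K w = j]) (F w)%:E =
             \int[P]_(w in [set w | K w = j]) (G w)%:E)%E ->
  (\int[P]_w (F w)%:E = \int[P]_w (G w)%:E)%E.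
Proof.
move=> mK mF mG F0 G0 FG.
have TE : \bigcup_j [set w | K w = j] = setT.
  by apply/seteqP; split => // w _; exists (K w).
have tK : trivIset setT (fun j => [set w | K w = j]).
  by move=> i j _ _ [w [/= <- <-]].
rewrite -TE !ge0_integral_bigcup ?TE//; last 4 first.
- by apply/measurable_EFinP.
- by move=> w _; rewrite lee_fin.
- by apply/measurable_EFinP.
- by move=> w _; rewrite lee_fin.
by apply: eq_eseriesr => j _; exact: FG.
Qed.

Lemma measurable_fun_preim_nat (K : T -> nat) (W : nat -> T -> R) :
  (forall j, measurable [set w | K w = j]) ->
  (forall j, measurable_fun setT (W j)) ->
  measurable_fun setT (fun w => W (K w) w).
Proof.
move=> mK mW.
have TE : \bigcup_j [set w | K w = j] = setT.
  by apply/seteqP; split => // w _; exists (K w).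
rewrite -TE; apply/measurable_fun_bigcup => // j.
apply: (@eq_measurable_fun _ _ _ _ _ (W j)) => [w|]; last exact: measurable_funTS.
by rewrite inE /= => ->.
Qed.

(** On [K = j] the integrand is [W j], which is independent of that event, so its integral there is
    [c j] times the probability of the event. *)
Lemma expectation_freeze_nat (K : T -> nat) (W : nat -> T -> R) (c : nat -> R) :
  (forall j, measurable [set w | K w = j]) ->
  (forall j, measurable_fun setT (W j)) -> (forall j w, 0 <= W j w) ->
  (forall j, \int[P]_w (W j w)%:E = (c j)%:E)%E ->
  (forall j U, measurable U -> P (W j @^-1` U `&` [set w | K w = j]) =
    (P (W j @^-1` U) * P [set w | K w = j])%E) ->
  (\int[P]_w (W (K w) w)%:E = \int[P]_w (c (K w))%:E)%E.
Proof.
move=> mK mW W0 EW ind.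
have c0 j : 0 <= c j by rewrite -lee_fin -EW; apply: integral_ge0 => w _; rewrite lee_fin.
apply: (@eq_expectation_preim_nat K) => //.
- exact: measurable_fun_preim_nat.
- by apply: (@measurable_fun_preim_nat K (fun j _ => c j)).
move=> j; rewrite (eq_integral (fun w => (W j w)%:E)); last by move=> w; rewrite inE => /= ->.
rewrite [RHS](eq_integral (fun w => (c j)%:E)); last by move=> w; rewrite inE => /= ->.
rewrite integral_cst//= -EW.
rewrite integral_mkcond.
rewrite (eq_integral (fun w => (W j w * \1_[set w | K w = j] w)%:E)); last first.
  move=> w _; rewrite patchE indicE; case: ifP => _; rewrite ?mulr1 ?mulr0//.
have mI : measurable_fun setT (\1_[set w | K w = j] : T -> R) by exact: measurable_indic.
rewrite ge0_expectationM//; first by rewrite integral_indic// setIT.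
move=> U V mU mV; rewrite preimage_indic.
(* The preimage of [U] under an indicator is empty, everything, the event or its complement; this
   settles the complement. *)
have PC : P (W j @^-1` U `&` ~` [set w | K w = j]) =
    (P (W j @^-1` U) * P (~` [set w | K w = j]))%E.
  have mWU : measurable (W j @^-1` U) by rewrite -[X in measurable X]setTI; exact: mW.
  rewrite -setDE measureD//; last by rewrite ltey_eq fin_num_measure.
  rewrite [X in (_ - X)%E]ind// probability_setC// muleBr ?mule1//; exact: fin_num_measure.
case: ifPn => _; case: ifPn => _ //.
- by rewrite setIT probability_setT mule1.
- exact: ind.
- by rewrite setI0 measure0 mule0.
Qed.

(* [grid 0] approaches [x] from below and [grid 1] strictly from above, for
   processes that are left- and right-continuous respectively. *)
Definition grid (b m : nat) (x : R) : R := (Num.truncn (x * m.+1%:R) + b)%:R / m.+1%:R.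

Lemma grid_ge0 b m x : 0 <= grid b m x.
Proof. by rewrite divr_ge0. Qed.

Lemma grid_le m x : 0 <= x -> grid 0 m x <= x.
Proof. by move=> x0; rewrite /grid addn0 ler_pdivrMr ?ltr0n// truncn_le mulr_ge0. Qed.

Lemma grid_gt m x : 0 <= x -> x < grid 1 m x.
Proof. by move=> x0; rewrite /grid addn1 ltr_pdivlMr ?ltr0n// truncnS_gt. Qed.

Lemma grid1E m x : grid 1 m x = grid 0 m x + m.+1%:R^-1.
Proof. by rewrite /grid addn0 addn1 -natr1 mulrDl mul1r. Qed.

Lemma cvg_grid b x : (b <= 1)%N -> 0 <= x -> grid b m x @[m --> \oo] --> x.
Proof.
move=> b1 x0.
have cV : x - m.+1%:R^-1 @[m --> \oo] --> x.
  by rewrite -[X in _ --> X]subr0; apply: cvgB; [exact: cvg_cst|exact: cvg_harmonic].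
have cV' : x + m.+1%:R^-1 @[m --> \oo] --> x.
  by rewrite -[X in _ --> X]addr0; apply: cvgD; [exact: cvg_cst|exact: cvg_harmonic].
apply: (squeeze_cvgr _ cV cV'); near=> m.
have := grid_le m x0; have := grid_gt m x0; rewrite grid1E => H1 H2.
have mV : 0 < m.+1%:R^-1 :> R by rewrite invr_gt0.
have : grid 0 m x <= grid b m x <= grid 0 m x + m.+1%:R^-1.
  by case: b b1 => [|[|//]] _; rewrite ?grid1E lexx ?andbT lerDl ltW.
move: mV H1 H2; rewrite /=; move: (grid b m x) (grid 0 m x) (m.+1%:R^-1) => g' g v v0 H1 H2.
by move=> /andP[? ?]; apply/andP; split; lra.
Unshelve. all: by end_near. Qed.

Let grid_index (X : T -> R) (m : nat) w := Num.truncn (X w * m.+1%:R).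

Let grid_indexE (X : T -> R) m j : (forall w, 0 <= X w) ->
  [set w | grid_index X m w = j] = X @^-1` `[j%:R / m.+1%:R, j.+1%:R / m.+1%:R[%classic.
Proof.
move=> X0; apply/seteqP; split => w /=; rewrite in_itv/= ler_pdivrMr ?ltr0n// ltr_pdivlMr ?ltr0n//.
  by move=> <-; apply: truncn_itv; rewrite mulr_ge0.
exact: truncn_def.
Qed.

Let measurable_grid_index (X : T -> R) m j : measurable_fun setT X -> (forall w, 0 <= X w) ->
  measurable [set w | grid_index X m w = j].
Proof.
move=> mX X0; rewrite grid_indexE// -[X in measurable X]setTI.
by apply: mX => //; exact: measurable_itv.
Qed.

Lemma measurable_fun_grid (X : T -> R) (Y : R -> T -> R) (b m : nat) :
  measurable_fun setT X -> (forall w, 0 <= X w) ->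
  (forall x, 0 <= x -> measurable_fun setT (Y x)) ->
  measurable_fun setT (fun w => Y (grid b m (X w)) w).
Proof.
move=> mX X0 mY.
apply: (@measurable_fun_preim_nat (grid_index X m) (fun j => Y ((j + b)%:R / m.+1%:R))) => j.
  exact: measurable_grid_index.
by apply: mY; rewrite divr_ge0.
Qed.

(** This plays the part of Fubini's theorem, with regularity of [Y] along a grid in place of joint
    measurability. For a discretised [X] it is [expectation_freeze_nat]; bounded convergence then
    removes the discretisation on both sides. The parameter [b] selects the side from which [X] is
    approached. *)
Lemma expectation_freeze (X : T -> R) (Y : R -> T -> R) (YX : T -> R) (h : R -> R)
    (C : R) (b : nat) : (b <= 1)%N ->
  measurable_fun setT X -> (forall w, 0 <= X w) ->
  (forall x, 0 <= x -> measurable_fun setT (Y x)) ->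
  (forall x w, 0 <= x -> 0 <= Y x w <= C) ->
  (forall x U V, 0 <= x -> measurable U -> measurable V ->
    P (Y x @^-1` U `&` X @^-1` V) = (P (Y x @^-1` U) * P (X @^-1` V))%E) ->
  (forall x, 0 <= x -> (\int[P]_w (Y x w)%:E = (h x)%:E)%E) ->
  measurable_fun setT YX ->
  {ae P, forall w, Y (grid b m (X w)) w @[m --> \oo] --> YX w} ->
  measurable_fun setT (h \o X) ->
  (forall x, 0 <= x -> h (grid b m x) @[m --> \oo] --> h x) ->
  (\int[P]_w (YX w)%:E = \int[P]_w (h (X w))%:E)%E.
Proof.
move=> b1 mX X0 mY Y0 ind EY mYX cY mh ch.
have h0C x : 0 <= x -> 0 <= h x <= C.
  move=> x0; rewrite -!lee_fin -EY//; apply/andP; split.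
    by apply: integral_ge0 => w _; rewrite lee_fin; have /andP[] := Y0 x w x0.
  rewrite -[leRHS]mule1 -(@probability_setT _ _ _ P) -integral_cst//.
  apply: ge0_le_integral => //=.
  - by move=> w _; rewrite lee_fin; have /andP[] := Y0 x w x0.
  - by apply/measurable_EFinP; exact: mY.
  - by move=> w _; rewrite lee_fin; have /andP[] := Y0 x w x0.
pose K := grid_index X.
have gr m j : 0 <= (j + b)%:R / m.+1%:R :> R by rewrite divr_ge0.
have step m : (\int[P]_w (Y (grid b m (X w)) w)%:E = \int[P]_w (h (grid b m (X w)))%:E)%E.
  apply: (@expectation_freeze_nat (K m) (fun j => Y ((j + b)%:R / m.+1%:R))
     (fun j => h ((j + b)%:R / m.+1%:R))) => //.
  - by move=> j; exact: measurable_grid_index.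
  - by move=> j; exact: mY.
  - by move=> j w; have /andP[] := Y0 _ w (gr m j).
  - by move=> j; exact: EY.
  - by move=> j U mU; rewrite /K grid_indexE// ind//; exact: measurable_itv.
have cvg1 : (\int[P]_w (Y (grid b m (X w)) w)%:E)%E @[m --> \oo] --> (\int[P]_w (YX w)%:E)%E.
  apply: (@bounded_cvg_expectation _ _ C) => //.
  - by move=> m; exact: measurable_fun_grid.
  - move=> m w; have /andP[H1 H2] := Y0 _ w (grid_ge0 b m (X w)).
    by rewrite ger0_norm.
have cvg2 : (\int[P]_w (h (grid b m (X w)))%:E)%E @[m --> \oo] --> (\int[P]_w (h (X w))%:E)%E.
  apply: (@bounded_cvg_expectation _ _ C) => //.
  - by move=> m; apply: (@measurable_fun_grid X (fun x _ => h x)) => // x _; exact: measurable_cst.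
  - by apply: aeW => w; exact: ch.
  - move=> m w; have /andP[H1 H2] := h0C _ (grid_ge0 b m (X w)).
    by rewrite ger0_norm.
have := cvg1; under eq_fun do rewrite step.
by move=> cvg1'; exact: (cvg_unique _ cvg1' cvg2).
Qed.
End probability_tools.

(** * Independence of generated sigma-algebras *)

Section independence.
Context d (T : measurableType d) (R : realType) (P : probability T R).

(* Both sides are finite measures in [E] that agree on a pi-system. *)
Lemma independent_sigma_algebra (G : set (set T)) (A : set T) : measurable A ->
  G `<=` measurable -> setI_closed G -> G setT ->
  (forall E, G E -> P (A `&` E) = (P A * P E)%E) ->
  forall E, <<s G >> E -> P (A `&` E) = (P A * P E)%E.
Proof.
move=> mA Gm GI GT indG E GE.
have PA0 : 0 <= fine (P A) by rewrite fine_ge0.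
have PAE : P A = (fine (P A))%:E by rewrite fineK ?fin_num_measure.
have mE B : mscale (NngNum PA0) P B = (P A * P B)%E by rewrite [in RHS]PAE.
transitivity (mrestr P mA E); first by rewrite /mrestr setIC.
transitivity (mscale (NngNum PA0) P E); last exact: mE.
apply: (@g_sigma_algebra_measure_unique _ R T G Gm (fun=> setT) (fun=> GT) _
  (mrestr P mA) (mscale (NngNum PA0) P) GI _ _ E GE).
- by rewrite bigcup_const//; exists 0%N.
- by move=> B GB; apply: etrans (esym (mE B)); rewrite /= /mrestr setIC; exact: indG.
- by move=> _; rewrite /= /mrestr setTI ltey_eq fin_num_measure.
Qed.

(** The pi-system consists of the intersections of one set from each [F j], [j] in [J]; on it,
    independence results from comparing the product formulas over [J] and over [J] enlarged by
    [i]. *)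
Lemma mutual_independence_family (I : choiceType) (F : I -> set (set T))
    (i : I) (J : {fset I}) :
  mutual_independence P F -> (i \notin J)%fset ->
  (forall j, F j `<=` measurable) -> (forall j, F j setT) ->
  (forall j, setI_closed (F j)) ->
  forall A E, F i A -> <<s [set B | exists2 j, (j \in J)%fset & F j B] >> E ->
  P (A `&` E) = (P A * P E)%E.
Proof.
move=> indF iJ Fm FT FI A E FA.
pose G := [set E | exists f : I -> set T, (forall j, F j (f j)) /\
   E = \bigcap_(j in [set` J]) f j].
have Gm : G `<=` measurable.
  move=> _ [f [Ff ->]]; apply: fin_bigcap_measurable; first exact: finite_fset.
  by move=> j _; apply: Fm (Ff j).
move=> GE; apply: (@independent_sigma_algebra G) => //; first exact: Fm FA.
- move=> _ _ [f [Ff ->]] [g [Fg ->]]; exists (fun j => f j `&` g j); split.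
    by move=> j; exact: FI.
  by rewrite bigcapI.
- by exists (fun=> setT); split=> //; rewrite bigcapT.
- move=> _ [f [Ff ->]].
  rewrite (indF J f); last by move=> j _; exact: Ff.
  have := indF (i |` J)%fset (fun j => if j == i then A else f j).
  rewrite big_fsetU1//= eqxx (eq_big_seq (fun j => P (f j))); last first.
    by move=> j jJ; case: eqP => // ji; rewrite -ji jJ in iJ.
  move=> <-; last first.
    by move=> j _; case: eqP => [->|_].
  congr (P _); apply/seteqP; split => w.
    move=> [Aw fw] j /=; rewrite in_fset1U => /orP[ji|jJ]; first by rewrite ji.
    by case: ifP => // _; exact: fw.
  move=> H; split; first by have := H i; rewrite /= fset1U1 eqxx; exact.
  move=> j jJ /=; have := H j; rewrite /= in_fset1U jJ orbT.
  by case: eqP => [ji|_]; [rewrite -ji jJ in iJ|exact].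
- move: GE; apply: smallest_sub; first exact: smallest_sigma_algebra.
  move=> B [j jJ FB]; apply: sub_sigma_algebra.
  exists (fun k => if k == j then B else setT); split.
    by move=> k; case: eqP => [->|_].
  apply/seteqP; split => w; first by move=> Bw k _; case: ifP.
  by move=> /(_ j jJ); rewrite eqxx.
Qed.

End independence.

(** * First passage of a continuous path *)

Section first_passage_path.
Context {R : realType}.
Variable b : R -> R.
Hypothesis b0 : b 0 = 0.
Hypothesis bc : {within `[0, +oo[%classic, continuous b}.
Implicit Types (x s t r : R).

Definition hitting x : R := inf [set s | 0 <= s /\ b s = x].

(** An inequality instead of [b r = x]: it is monotone in the level and in the horizon, and can be
    tested on grid points. For [0 <= x] the intermediate value theorem recovers a hit. *)
Definition reached x s := exists2 r : R, 0 <= r <= s & x <= b r.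

Lemma path_cvg (s_ : nat -> R) s : (forall n, 0 <= s_ n) -> 0 <= s ->
  s_ @ \oo --> s -> (b \o s_) @ \oo --> b s.
Proof.
move=> s_0 s0 s_s.
have /subspace_continuousP/(_ s) := bc; rewrite /= in_itv/= andbT => /(_ s0) bs.
move=> U /bs bU.
have [M _ HM] := s_s _ bU; exists M => // n Mn.
by apply: (HM n Mn); rewrite /= in_itv/= s_0.
Qed.

Let bc_itv s : {within `[0, s]%classic, continuous b}.
Proof.
by apply: continuous_subspaceW bc => r /=; rewrite !in_itv/= andbT => /andP[].
Qed.

Lemma reached_hit x s : 0 <= x -> reached x s -> exists2 r : R, 0 <= r <= s & b r = x.
Proof.
move=> x0 [r /andP[r0 rs] xr].
have [|c] := @IVT R b 0 r x r0 (@bc_itv r).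
  by rewrite b0 min_l ?(le_trans x0)// max_r ?(le_trans x0)// x0.
rewrite in_itv/= => /andP[c0 cr] cx.
by exists c => //; rewrite c0 (le_trans cr).
Qed.

Lemma hitting_ge0 x : 0 <= hitting x.
Proof.
rewrite /hitting; set S := [set s | _].
have [->|/set0P SN0] := eqVneq S set0; first by rewrite inf0.
by apply: lb_le_inf => // s [].
Qed.

Lemma hitting_never x : 0 <= x -> (forall s, ~ reached x s) -> hitting x = 0.
Proof.
move=> x0 nr; rewrite /hitting (_ : [set s | _] = set0) ?inf0//.
apply/seteqP; split => // s [s0 bs]; apply: (nr s); exists s; last by rewrite bs.
by rewrite s0 lexx.
Qed.

Lemma hitting_lb x s : 0 <= s -> b s = x -> hitting x <= s.
Proof.
move=> s0 bs; apply: ge_inf; last by split.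
by exists 0 => r [].
Qed.

(** By continuity the infimum of the hitting times is attained. *)
Lemma hittingK x t : 0 <= x -> reached x t -> b (hitting x) = x.
Proof.
move=> x0 /(reached_hit x0)[s /andP[s0 _] bs].
pose S := [set s | 0 <= s /\ b s = x].
have infS : has_inf S by split; [exists s|exists 0 => r []].
have H n : exists r, S r /\ r < hitting x + n.+1%:R^-1.
  have n0 : 0 < n.+1%:R^-1 :> R by rewrite invr_gt0.
  by have [r Sr rlt] := inf_adherent n0 infS; exists r.
have [s_ s_P] := choice H.
have s_cvg : s_ @ \oo --> hitting x.
  have c1 : (fun _ : nat => hitting x) @ \oo --> hitting x by exact: cvg_cst.
  have c2 : hitting x + n.+1%:R^-1 @[n --> \oo] --> hitting x.
    by rewrite -[X in _ --> X]addr0; apply: cvgD; [exact: cvg_cst|exact: cvg_harmonic].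
  apply: (squeeze_cvgr _ c1 c2); near=> n.
  have [[r0 rx] rlt] := s_P n; rewrite /= (ltW rlt) andbT.
  exact: hitting_lb.
have := path_cvg (fun n => (s_P n).1.1) (hitting_ge0 x) s_cvg.
rewrite (_ : b \o s_ = fun=> x); last by apply/funext => n; exact: (s_P n).1.2.
move=> H1; have H2 : (fun _ : nat => x) @ \oo --> x by exact: cvg_cst.
exact: (cvg_unique _ H1 H2).
Unshelve. all: by end_near. Qed.

Lemma hitting_leP x t s : 0 <= x -> reached x t -> 0 <= s ->
  hitting x <= s <-> reached x s.
Proof.
move=> x0 xt s0; split.
  by move=> hs; exists (hitting x); [rewrite hitting_ge0|rewrite (hittingK x0 xt)].
by move=> /(reached_hit x0)[r /andP[r0 rs] br]; rewrite (le_trans _ rs)// hitting_lb.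
Qed.

(* A level that is never reached has [hitting x = inf set0 = 0]. *)
Lemma hitting_le_split x t : 0 <= x ->
  hitting x <= t <-> 0 <= t /\ (reached x t \/ forall k : nat, ~ reached x k%:R).
Proof.
move=> x0; split.
  move=> ht; have t0 : 0 <= t by rewrite (le_trans (hitting_ge0 x)).
  split=> //; have [[s xs]|nr] := pselect (exists s, reached x s).
    by left; exact/(hitting_leP x0 xs).
  by right => k xk; apply: nr; exists k%:R.
move=> [t0 [xt|nr]]; first exact/(hitting_leP x0 xt).
rewrite hitting_never// => s [r /andP[r0 rs] xr].
apply: (nr (Num.truncn r).+1); exists r => //.
by rewrite r0 ltW// truncnS_gt.
Qed.

(** Countably many values of the path decide the matter, hence measurability. Conversely, if the
    maximum of the path on [[0, s]] were below [x], the gap would exclude all grid values close to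
    [x]. *)
Lemma reached_gridP x s : 0 <= s ->
  reached x s <-> forall m : nat, exists n i : nat,
    i%:R / n.+1%:R <= s /\ x - m.+1%:R^-1 < b (i%:R / n.+1%:R).
Proof.
move=> s0; split.
  move=> [r /andP[r0 rs] xr] m.
  have m0 : 0 < m.+1%:R^-1 :> R by rewrite invr_gt0.
  have := path_cvg (fun n => grid_ge0 0 n r) r0 (cvg_grid (leq0n 1) r0).
  move=> /cvgrPdist_lt/(_ _ m0)[n _ /(_ n (leqnn n))] /=.
  rewrite /grid addn0 => H; exists n, (Num.truncn (r * n.+1%:R)); split.
    by have := grid_le n r0; rewrite /grid addn0 => /le_trans; exact.
  by move: H; rewrite ltr_norml => /andP[_]; rewrite ltrBlDr ltrBlDl; exact: le_lt_trans.
move=> H; have [r] := @EVT_max R b 0 _ s0 (@bc_itv s).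
rewrite in_itv/= => rs rmax; exists r => //.
rewrite leNgt; apply/negP => rx.
have m0 : 0 < x - b r by rewrite subr_gt0.
(* Chosen so that [m.+1%:R^-1] is less than the gap [x - b r]. *)
pose m := Num.truncn (x - b r)^-1.
have [n [i [ile]]] := H m.
apply/negP; rewrite -leNgt.
have /rmax/le_trans : i%:R / n.+1%:R \in `[0, s]%R by rewrite in_itv/= divr_ge0.
apply; rewrite lerBrDl -lerBrDr ltW//.
by rewrite -[ltRHS]invrK ltf_pV2 ?posrE ?invr_gt0// truncnS_gt.
Qed.

Lemma hitting_homo x y t : 0 <= x -> x <= y -> reached y t -> hitting x <= hitting y.
Proof.
move=> x0 xy yt; have y0 := le_trans x0 xy.
have [r rt yr] := yt.
have xt : reached x t by exists r => //; exact: le_trans yr.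
apply/(hitting_leP x0 xt); first exact: hitting_ge0.
by exists (hitting y); [rewrite hitting_ge0 lexx|rewrite (hittingK y0 yt)].
Qed.

(** Up to time [hitting x - e] the path has a maximum strictly below [x], hence eventually below
    [x_ n], which therefore is hit later than that time. *)
Lemma hitting_left_continuous (x_ : nat -> R) x t : (forall n, 0 <= x_ n <= x) ->
  x_ @ \oo --> x -> reached x t -> (hitting \o x_) @ \oo --> hitting x.
Proof.
move=> x_x x_cvg xt.
have x0 : 0 <= x by have /andP[H1 H2] := x_x 0%N; exact: le_trans H2.
apply/cvgrPdist_le => e e0.
have le_h n : hitting (x_ n) <= hitting x.
  by have /andP[H1 H2] := x_x n; exact: hitting_homo xt.
have [s0|s0] := ltP (hitting x - e) 0.
  near=> n; rewrite /= ger0_norm ?subr_ge0 ?le_h//.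
  by have := hitting_ge0 (x_ n); lra.
have [r] := @EVT_max R b 0 _ s0 (@bc_itv (hitting x - e)).
rewrite in_itv/= => rs rmax.
have rx : b r < x.
  rewrite ltNge; apply/negP => xr.
  have /(hitting_leP x0 xt s0) : reached x (hitting x - e) by exists r.
  by lra.
have H : \forall n \near \oo, b r < x_ n by exact: (cvgr_gt x).
near=> n; rewrite /= ger0_norm ?subr_ge0 ?le_h// lerBlDl -lerBlDr leNgt; apply/negP => hlt.
have /andP[H1 H2] := x_x n.
have xnt : reached (x_ n) t by have [r' r't ?] := xt; exists r' => //; exact: le_trans H2 _.
have [r'] := (hitting_leP H1 xnt s0).1 (ltW hlt).
move=> r's; apply/negP; rewrite -ltNge.
by apply: (le_lt_trans (rmax r' _)); [rewrite in_itv|near: n].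
Unshelve. all: by end_near. Qed.

End first_passage_path.

(** * Measurability of the passage time at a random level *)

Section first_passage_measurable.
Context d (T : measurableType d) (R : realType).

Lemma measurable_fun_le_set (f : T -> R) :
  (forall t : R, measurable [set w | f w <= t]) -> measurable_fun setT f.
Proof.
move=> H; apply: (measurability _ (RGenOInfty.measurableE R)) => //.
move=> _ [_ [x ->] <-]; rewrite setTI.
rewrite (_ : _ @^-1` _ = ~` [set w | f w <= x]); first exact: measurableC.
apply/seteqP; split => w /=; rewrite in_itv/= andbT ltNge; first exact/negP.
by move/negP.
Qed.

Variable B : R -> T -> R.
Hypothesis B0 : forall w, B 0 w = 0.
Hypothesis Bc : forall w, {within `[0, +oo[%classic, continuous (fun t => B t w)}.
Hypothesis mB : forall t, 0 <= t -> measurable_fun setT (B t).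

Lemma measurable_reached (X : T -> R) (s : R) : measurable_fun setT X -> 0 <= s ->
  measurable [set w | reached (B^~ w) (X w) s].
Proof.
move=> mX s0.
rewrite (_ : [set w | _] = \bigcap_(m : nat) \bigcup_(n : nat)
    \bigcup_(i in [set i : nat | i%:R / n.+1%:R <= s])
      [set w | X w - m.+1%:R^-1 < B (i%:R / n.+1%:R) w]).
  apply: bigcapT_measurable => m; apply: bigcupT_measurable => n.
  apply: bigcup_measurable => i _.
  have := @measurable_fun_ltr _ _ _ setT (fun w => X w - m.+1%:R^-1) (B (i%:R / n.+1%:R)).
  move=> /(_ (measurable_funB mX (measurable_cst _)) (mB (divr_ge0 (ler0n _ _) (ler0n _ _)))).
  by move=> /(_ measurableT [set true]); rewrite setTI; apply.
apply/seteqP; split => w.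
  move=> /(reached_gridP (@Bc w) _ s0) H m _; have [n [i [H1 H2]]] := H m.
  by exists n => //; exists i.
move=> H; apply/(reached_gridP (@Bc w) _ s0) => m.
by have [n _ [i H1 H2]] := H m I; exists n, i.
Qed.

Lemma measurable_first_passage (X : T -> R) :
  measurable_fun setT X -> (forall w, 0 <= X w) ->
  measurable_fun setT (fun w => first_passage B (X w) w).
Proof.
move=> mX X0; pose reach s := [set w | reached (B^~ w) (X w) s].
have mreach s : 0 <= s -> measurable (reach s) by exact: measurable_reached.
apply: measurable_fun_le_set => t.
have [t0|t0] := ltP t 0.
  rewrite (_ : [set w | _] = set0)//; apply/seteqP; split => // w /=.
  by apply/negP; rewrite -ltNge (lt_le_trans t0)// hitting_ge0.
rewrite (_ : [set w | _] = reach t `|` \bigcap_(k : nat) ~` reach k%:R).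
  apply: measurableU; first exact: mreach.
  by apply: bigcapT_measurable => k; apply: measurableC; exact: mreach.
apply/seteqP; split => w.
  move=> /(hitting_le_split (B0 w) (@Bc w) _ (X0 w))[_ [H|H]]; [by left|right => k _].
  exact: H.
move=> H; apply/(hitting_le_split (B0 w) (@Bc w) _ (X0 w)); split => //.
by case: H => [H|H]; [left|right => k; exact: H].
Qed.

End first_passage_measurable.

(** * Optional stopping of the exponential martingale on a grid *)

Section grid_exit.
Context {R : realType}.
Implicit Types (b : R -> R) (x h theta t y : R) (n : nat).

Definition grid_crossed b x h n := has (fun j => x < b (j%:R * h)) (iota 0 n.+1).

(** [find] returns [n] when no index below [n] qualifies, so this is the first crossing index
    stopped at [n]. The range excludes [n], contrary to that of [grid_crossed]: a crossing at [n]
    gives the value [n] anyway. *)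
Definition grid_exit b x h n := find (fun j => x < b (j%:R * h)) (iota 0 n).

(** The exponential martingale of Brownian motion, at time [t] and position [y]. *)
Definition wald theta t y := expR (theta * y - theta ^+ 2 / 2 * t).

Definition stopped_wald theta b x h n :=
  let t := (grid_exit b x h n)%:R * h in wald theta t (b t).

Lemma grid_crossedS b x h n :
  grid_crossed b x h n.+1 = grid_crossed b x h n || (x < b (n.+1%:R * h)).
Proof. by rewrite /grid_crossed -[n.+2]addn1 iotaD has_cat/= orbF. Qed.

Lemma grid_exit_leq b x h n : (grid_exit b x h n <= n)%N.
Proof. by rewrite /grid_exit -[leqRHS](size_iota 0) find_size. Qed.

Lemma grid_exit_not_crossed b x h n : ~~ grid_crossed b x h n -> grid_exit b x h n = n.
Proof.
rewrite /grid_crossed /grid_exit -addn1 iotaD has_cat negb_or => /andP[/hasNfind -> _].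
by rewrite size_iota.
Qed.

Lemma grid_exitS b x h n : grid_exit b x h n.+1 =
  if grid_crossed b x h n then grid_exit b x h n else n.+1.
Proof.
case: ifPn => [|ncr].
  rewrite /grid_crossed /grid_exit -addn1 iotaD has_cat find_cat size_iota /= orbF.
  case: ifPn => // /hasNfind -> /=; rewrite size_iota add0n => ->.
  by rewrite addn0.
rewrite /grid_exit hasNfind ?size_iota//.
Qed.

Lemma stopped_waldS theta b x h n : stopped_wald theta b x h n.+1 =
  if grid_crossed b x h n then stopped_wald theta b x h n
  else wald theta (n.+1%:R * h) (b (n.+1%:R * h)).
Proof. by rewrite /stopped_wald grid_exitS; case: ifP. Qed.

Lemma stopped_wald_not_crossed theta b x h n : ~~ grid_crossed b x h n ->
  stopped_wald theta b x h n = wald theta (n%:R * h) (b (n%:R * h)).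
Proof. by move=> ncr; rewrite /stopped_wald grid_exit_not_crossed. Qed.

Lemma measurable_wald theta t : measurable_fun setT (wald theta t).
Proof.
apply: measurableT_comp; first exact: measurable_expR.
by apply: measurable_funB => //; exact: measurable_funM.
Qed.

Section measurable_grid.
Context d (T : measurableType d) (B : R -> T -> R) (x h : R).

Lemma measurable_grid_crossed n :
  (forall j, (j <= n)%N -> measurable_fun setT (B (j%:R * h))) ->
  measurable_fun setT (fun w => grid_crossed (B^~ w) x h n).
Proof.
have lt t : measurable_fun setT (B t) -> measurable_fun setT (fun w => x < B t w).
  by move=> mBt; apply: measurable_fun_ltr.
elim: n => [|n IH] mB.
  rewrite (_ : (fun w => _) = (fun w => x < B (0%:R * h) w)); first exact/lt/mB.
  by apply/funext => w; rewrite /grid_crossed/= orbF.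
rewrite (_ : (fun w => _) = (fun w => grid_crossed (B^~ w) x h n || (x < B (n.+1%:R * h) w))).
  apply: measurable_or; last exact/lt/mB.
  by apply: IH => j jn; exact/mB/leqW.
by apply/funext => w; rewrite grid_crossedS.
Qed.

Lemma measurable_stopped_wald theta n :
  (forall j, (j <= n)%N -> measurable_fun setT (B (j%:R * h))) ->
  measurable_fun setT (fun w => stopped_wald theta (B^~ w) x h n).
Proof.
have mw j : measurable_fun setT (B (j%:R * h)) ->
    measurable_fun setT (fun w => wald theta (j%:R * h) (B (j%:R * h) w)).
  by move=> mBj; apply: measurableT_comp mBj; exact: measurable_wald.
elim: n => [|n IH] mB; first exact/mw/mB.
rewrite (_ : (fun w => _) = (fun w => if grid_crossed (B^~ w) x h n
    then stopped_wald theta (B^~ w) x h n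
    else wald theta (n.+1%:R * h) (B (n.+1%:R * h) w))); last first.
  by apply/funext => w; rewrite stopped_waldS.
have mB' j : (j <= n)%N -> measurable_fun setT (B (j%:R * h)) by move=> jn; exact/mB/leqW.
apply: measurable_fun_ifT; [exact: measurable_grid_crossed|exact: IH|exact/mw/mB].
Qed.

End measurable_grid.
End grid_exit.

(** * The exponential martingale at grid times *)

Section brownian_laplace.
Context d (T : measurableType d) (R : realType) (P : probability T R).
Implicit Types (s t x theta mu : R).

Lemma integral_normal_expR theta (sigma : R) : 0 < sigma ->
  (\int[normal_prob 0 sigma]_y (expR (theta * y))%:E = (expR (theta ^+ 2 * sigma ^+ 2 / 2))%:E)%E.
Proof.
move=> s0; have sN0 : sigma != 0 by rewrite gt_eqF.
have mexp : measurable_fun setT (fun y : R => (expR (theta * y))%:E).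
  apply/measurable_EFinP; apply: measurableT_comp; first exact: measurable_expR.
  exact: measurable_funM.
have dom := normal_prob_dominates 0 sigma.
rewrite -(Radon_Nikodym_SigmaFinite.change_of_variables dom _ measurableT mexp); last first.
  by move=> y; rewrite lee_fin expR_ge0.
transitivity (\int[lebesgue_measure]_y ((expR (theta * y))%:E * (normal_pdf 0 sigma y)%:E))%E.
  apply: ae_eq_integral => //.
  - apply: emeasurable_funM => //; apply: (measurable_int lebesgue_measure).
    exact: Radon_Nikodym_SigmaFinite.f_integrable.
  - apply: emeasurable_funM => //; apply/measurable_EFinP; exact: measurable_normal_pdf.
  - apply: ae_eqe_mul2l; apply: integral_ae_eq => //.
    + exact: Radon_Nikodym_SigmaFinite.f_integrable.
    + by apply/measurable_EFinP; exact: measurable_normal_pdf.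
    + by move=> E _ mE; rewrite -Radon_Nikodym_SigmaFinite.f_integral.
(* Completing the square: the exponential tilt shifts the mean to [theta * sigma ^+ 2]. *)
transitivity (\int[lebesgue_measure]_y ((expR (theta ^+ 2 * sigma ^+ 2 / 2))%:E *
    (normal_pdf (theta * sigma ^+ 2) sigma y)%:E))%E.
  apply: eq_integral => y _; rewrite -!EFinM; congr EFin.
  have pdfE m : normal_pdf m sigma y = normal_peak sigma * normal_fun m sigma y.
    by rewrite normal_pdfE.
  rewrite !pdfE mulrCA [RHS]mulrCA; congr (_ * _).
  by rewrite /normal_fun -!expRD; congr expR; field.
rewrite ge0_integralZl//.
- by rewrite integral_normal_pdf// mule1.
- by apply/measurable_EFinP; exact: measurable_normal_pdf.
- by move=> y _; rewrite lee_fin normal_pdf_ge0.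
Qed.

Variable B : R -> T -> R.
Hypothesis BM : standard_brownian_motion P B.

Let mB t : 0 <= t -> measurable_fun setT (B t).
Proof. exact: (bm_measurable BM). Qed.

Lemma brownian_increment_expR theta s t : 0 <= s -> s < t ->
  (\int[P]_w (expR (theta * (B t w - B s w)))%:E = (expR (theta ^+ 2 * (t - s) / 2))%:E)%E.
Proof.
move=> s0 st; have t0 : 0 <= t by rewrite (le_trans s0)// ltW.
have mD : measurable_fun setT (fun w => B t w - B s w).
  by apply: measurable_funB; exact: mB.
pose D : {mfun T >-> measurableTypeR R} := HB.pack (fun w => B t w - B s w)
  (isMeasurableFun.Build _ _ T (measurableTypeR R) _ mD).
have mexp : measurable_fun setT (fun y : measurableTypeR R => (expR (theta * y))%:E).
  apply/measurable_EFinP; apply: measurableT_comp; first exact: measurable_expR.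
  exact: measurable_funM.
transitivity (\int[distribution P D]_y (expR (theta * y))%:E)%E.
  by rewrite ge0_integral_distribution// => y; rewrite lee_fin expR_ge0.
have ts0 : 0 < t - s by rewrite subr_gt0.
transitivity (\int[normal_prob 0 (Num.sqrt (t - s))]_y (expR (theta * y))%:E)%E.
  by apply: eq_measure_integral => A mA _; exact: (bm_gaussian BM s0 st mA).
by rewrite integral_normal_expR ?sqrtr_gt0// sqr_sqrtr// ltW.
Qed.


(* [T'] stands for [T] with the sigma-algebra generated by [B] up to time [s]. *)
Lemma process_sigma_measurable (s : R) (f : T -> R) :
  (forall (d' : measure_display) (T' : measurableType d') (i : T' -> T),
     (forall t, 0 <= t <= s -> measurable_fun setT (B t \o i)) ->
     measurable_fun setT (f \o i)) ->
  forall V, measurable V -> process_sigma `[0, s]%classic B (f @^-1` V).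
Proof.
move=> H V mV.
pose G := [set A | exists t (V : set R), [/\ `[0, s]%classic t, measurable V & A = B t @^-1` V]].
have := H _ (g_sigma_algebraType G) idfun.
move=> /(_ _ measurableT V mV); rewrite setTI; apply.
move=> t ts _ U mU; rewrite setTI; apply: sub_sigma_algebra.
by exists t, U; split => //=; rewrite in_itv.
Qed.

(** Discrete optional stopping. On paths that have crossed ([V]) the value is frozen; on the others
    ([U]) one step multiplies it by [xi], which has mean 1 and is independent of the past, on which
    [U] depends. *)
Lemma expectation_stopped_wald theta x (h : R) n : 0 < h ->
  (\int[P]_w (stopped_wald theta (B^~ w) x h n)%:E = 1)%E.
Proof.
move=> h0; have nh0 j : 0 <= j%:R * h by rewrite mulr_ge0// ltW.
have mBj j : measurable_fun setT (B (j%:R * h)) by exact: mB.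
elim: n => [|n IH].
  rewrite (eq_integral (fun=> 1%E)); last first.
    by move=> w _; rewrite /stopped_wald /wald/= !mul0r (bm_start BM) !mulr0 subr0 expR0.
  by rewrite integral_cst// mul1e; exact: probability_setT.
pose c w := grid_crossed (B^~ w) x h n.
pose V w := if c w then stopped_wald theta (B^~ w) x h n else 0.
pose U w := if c w then 0 else stopped_wald theta (B^~ w) x h n.
pose xi w := wald theta h (B (n.+1%:R * h) w - B (n%:R * h) w).
have mc : measurable_fun setT c by apply: measurable_grid_crossed.
have mW : measurable_fun setT (fun w => stopped_wald theta (B^~ w) x h n).
  by apply: measurable_stopped_wald.
have mV : measurable_fun setT V by exact: measurable_fun_ifT.
have mU : measurable_fun setT U by exact: measurable_fun_ifT.
have mxi : measurable_fun setT xi.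
  apply: (measurableT_comp (measurable_wald theta h)); exact: measurable_funB.
have W0 w : 0 <= stopped_wald theta (B^~ w) x h n by exact: expR_ge0.
have V0 w : 0 <= V w by rewrite /V; case: ifP.
have U0 w : 0 <= U w by rewrite /U; case: ifP.
have xi0 w : 0 <= xi w by exact: expR_ge0.
have nS : n%:R * h < n.+1%:R * h by rewrite ltr_pM2r// ltr_nat.
have Exi : (\int[P]_w (xi w)%:E = 1)%E.
  transitivity (\int[P]_w ((expR (- (theta ^+ 2 / 2 * h)))%:E *
     (expR (theta * (B (n.+1%:R * h) w - B (n%:R * h) w)))%:E))%E.
    by apply: eq_integral => w _; rewrite -EFinM -expRD addrC.
  rewrite ge0_integralZl//.
  - rewrite brownian_increment_expR// -EFinM -expRD.
    by rewrite (_ : _ + _ = 0) ?expR0//; rewrite -natr1; field.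
  - apply/measurable_EFinP; apply: measurableT_comp; first exact: measurable_expR.
    by apply: measurable_funM => //; exact: measurable_funB.
have EUxi : (\int[P]_w (U w * xi w)%:E = \int[P]_w (U w)%:E)%E.
  rewrite ge0_expectationM ?Exi ?mule1// => A1 A2 mA1 mA2.
  apply: (bm_indep_increments BM (V := wald theta h @^-1` A2)) => //.
    apply: process_sigma_measurable => // d' T' i mBi.
    have mBj' j : (j <= n)%N -> measurable_fun setT (B (j%:R * h) \o i).
      by move=> jn; apply: mBi; rewrite nh0 ler_pM2r// ler_nat.
    apply: measurable_fun_ifT => //.
      exact: (@measurable_grid_crossed _ _ _ (fun t => B t \o i)).
    exact: (@measurable_stopped_wald _ _ _ (fun t => B t \o i)).
  by rewrite -[X in measurable X]setTI; exact: measurable_wald.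
transitivity (\int[P]_w ((V w)%:E + (U w * xi w)%:E))%E.
  apply: eq_integral => w _; rewrite -EFinD; congr EFin.
  rewrite stopped_waldS /V /U -/(c w); case: ifPn => cw; first by rewrite mul0r addr0.
  rewrite add0r stopped_wald_not_crossed// /xi /wald -expRD; congr expR.
  by rewrite -natr1; field.
have V0' w : setT w -> (0 <= (V w)%:E)%E by rewrite lee_fin.
have U0' w : setT w -> (0 <= (U w)%:E)%E by rewrite lee_fin.
have Ux0 w : setT w -> (0 <= (U w * xi w)%:E)%E by rewrite lee_fin mulr_ge0.
have mV' : measurable_fun setT (EFin \o V) by exact/measurable_EFinP.
have mU' : measurable_fun setT (EFin \o U) by exact/measurable_EFinP.
have mUx : measurable_fun setT (fun w => (U w * xi w)%:E).
  by apply/measurable_EFinP; exact: measurable_funM.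
rewrite ge0_integralD// EUxi -ge0_integralD//.
rewrite -IH; apply: eq_integral => w _; rewrite -EFinD /V /U.
by case: ifP; rewrite ?addr0 ?add0r.
Qed.

(* The square is dominated by the exponential martingale of parameter [2 * theta]. *)
Lemma expectation_stopped_wald_sqr theta x (h K : R) n : 0 < h -> n%:R * h <= K ->
  (\int[P]_w (stopped_wald theta (B^~ w) x h n ^+ 2)%:E <= (expR (theta ^+ 2 * K))%:E)%E.
Proof.
move=> h0 nhK.
have m2 : measurable_fun setT (fun w => stopped_wald (2 * theta) (B^~ w) x h n).
  by apply: measurable_stopped_wald => j _; apply: mB; rewrite mulr_ge0// ltW.
have m1 : measurable_fun setT (fun w => stopped_wald theta (B^~ w) x h n).
  by apply: measurable_stopped_wald => j _; apply: mB; rewrite mulr_ge0// ltW.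
rewrite -[leRHS]mule1 -(expectation_stopped_wald (2 * theta) x n h0).
have m2' : measurable_fun setT (fun w => (stopped_wald (2 * theta) (B^~ w) x h n)%:E).
  exact/measurable_EFinP.
rewrite -ge0_integralZl//; last by move=> w _; rewrite lee_fin expR_ge0.
apply: ge0_le_integral => //.
- by move=> w _; rewrite lee_fin sqr_ge0.
- by apply/measurable_EFinP; exact: measurable_funX.
- exact: emeasurable_funM.
move=> w _; rewrite -EFinM lee_fin /stopped_wald /wald/=.
set t := _%:R * h; rewrite -expRM_natl -expRD ler_expR.
have tK : t <= K.
  by rewrite (le_trans _ nhK)// ler_pM2r// ler_nat grid_exit_leq.
have := ler_wpM2l (sqr_ge0 theta) tK.
set y := B t w; rewrite exprMn; move: (theta ^+ 2) => q H.
have -> : 2 ^+ 2 * q / 2 = 2 * q by field.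
lra.
Qed.
End brownian_laplace.

(** * Refining the grid *)

Section capped_exit.
Context {R : realType}.
Variables (b : R -> R) (x : R) (K : nat).
Hypothesis b0 : b 0 = 0.
Hypothesis bc : {within `[0, +oo[%classic, continuous b}.
Hypothesis x0 : 0 <= x.

(** Strict crossing is what refined grids detect. Adjoining [K] caps the exit at the horizon and
    keeps the infimum away from the empty set. *)
Definition exit_set := [set s : R | 0 <= s /\ x < b s] `|` [set K%:R].

Definition capped_exit : R := inf exit_set.

Let inf_exit : has_inf exit_set.
Proof.
split; first by exists K%:R; right.
by exists 0 => s [[]//|->].
Qed.

Let exitK : exit_set K%:R. Proof. by right. Qed.

Lemma capped_exit_ge0 : 0 <= capped_exit.
Proof. by apply: lb_le_inf; [exists K%:R|move=> s [[]//|->]]. Qed.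

Lemma capped_exit_lb s : exit_set s -> capped_exit <= s.
Proof. by move=> es; apply: ge_inf => //; exists 0 => r [[]//|->]. Qed.

(** Before the exit the path is at most [x]; approach the exit from the left. An exit at time 0 is
    covered by [b 0 = 0]. *)
Lemma capped_exit_val : b capped_exit <= x.
Proof.
pose s_ (n : nat) := capped_exit * (1 - n.+1%:R^-1).
have V1 n : n.+1%:R^-1 <= 1 :> R by rewrite invf_le1 ?ltr0n// ler1n.
have s_0 n : 0 <= s_ n by rewrite mulr_ge0 ?capped_exit_ge0// subr_ge0.
have cs : s_ @ \oo --> capped_exit.
  rewrite -[X in _ --> X]mulr1 -[X in _ * X]subr0.
  apply: cvgM; first exact: cvg_cst.
  by apply: cvgB; [exact: cvg_cst|exact: cvg_harmonic].
have bs := path_cvg bc s_0 capped_exit_ge0 cs.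
apply: (cvgr_to_le bs).
near=> n; have := capped_exit_ge0; rewrite le_eqVlt => /predU1P[t0|t0].
  by rewrite /= /s_ -t0 mul0r b0.
rewrite /= leNgt; apply/negP => xb.
have : capped_exit <= s_ n by apply: capped_exit_lb; left.
rewrite leNgt => /negP; apply.
by rewrite /s_ gtr_pMr// ltrBlDr ltrDl invr_gt0.
Unshelve. all: by end_near. Qed.

Lemma capped_exit_ge_hitting : reached b x K%:R -> hitting b x <= capped_exit.
Proof.
move=> xK; apply: lb_le_inf; first by exists K%:R.
move=> s [[s0 xs]|->]; last exact/(hitting_leP b0 bc x0 xK).
by apply/(hitting_leP b0 bc x0 xK) => //; exists s; [rewrite s0 lexx|exact: ltW].
Qed.

Lemma capped_exit_ge_horizon : ~ reached b x K%:R -> K%:R <= capped_exit.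
Proof.
move=> xK; apply: lb_le_inf; first by exists K%:R.
move=> s [[s0 xs]|->//]; rewrite leNgt; apply/negP => sK.
by apply: xK; exists s; [rewrite s0 ltW|exact: ltW].
Qed.

(** A path at [x'] is already above [x], which bounds the exit time. Times at which the path is
    above [x] come arbitrarily close to the exit from the right, and continuity gives the height. *)
Lemma capped_exit_le_hitting x' : x < x' -> reached b x' K%:R ->
  capped_exit <= hitting b x' /\ x <= b capped_exit.
Proof.
move=> xx' x'K; have x'0 : 0 <= x' by rewrite (le_trans x0)// ltW.
have bH := hittingK b0 bc x'0 x'K; have H0 := hitting_ge0 b x'.
have HK : hitting b x' <= K%:R by exact/(hitting_leP b0 bc x'0 x'K).
have HS : exit_set (hitting b x') by left; split => //; rewrite bH.
split; first exact: capped_exit_lb.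
have H n : exists r, [/\ 0 <= r, x < b r & capped_exit <= r < capped_exit + n.+1%:R^-1].
  have n0 : 0 < n.+1%:R^-1 :> R by rewrite invr_gt0.
  have [r Sr rlt] := inf_adherent n0 inf_exit.
  case: Sr rlt => [[r0 xr] rlt|-> Klt].
    by exists r; split => //; rewrite rlt andbT; apply: capped_exit_lb; left.
  (* When the horizon is the near-minimiser, the passage at [x'] replaces it, as it comes no later
     than [K]. *)
  exists (hitting b x'); split => //; first by rewrite bH.
  by rewrite capped_exit_lb//= (le_lt_trans HK).
have [s_ s_P] := choice H.
have c1 : (fun _ : nat => capped_exit) @ \oo --> capped_exit by exact: cvg_cst.
have c2 : capped_exit + n.+1%:R^-1 @[n --> \oo] --> capped_exit.
  by rewrite -[X in _ --> X]addr0; apply: cvgD; [exact: cvg_cst|exact: cvg_harmonic].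
have s_cvg : s_ @ \oo --> capped_exit.
  apply: (squeeze_cvgr _ c1 c2); near=> n.
  by have [_ _ /andP[-> /ltW ->]] := s_P n.
have s_0 n : 0 <= s_ n by have [] := s_P n.
have bs := path_cvg bc s_0 capped_exit_ge0 s_cvg.
apply: (cvgr_to_ge bs); near=> n; have [_ /ltW xs _] := s_P n; exact: xs.
Unshelve. all: by end_near. Qed.

(** A grid exit belongs to [exit_set], which gives the lower bound. For the upper one, take [s] in
    that set close to the infimum: grid points just below [s] eventually see the path above [x]. The
    [K * m.+1] steps end exactly at [K]. *)
Lemma cvg_grid_exit :
  (grid_exit b x m.+1%:R^-1 (K * m.+1))%:R * m.+1%:R^-1 @[m --> \oo] --> capped_exit.
Proof.
pose p m j := x < b (j%:R * m.+1%:R^-1).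
pose g m : R := (grid_exit b x m.+1%:R^-1 (K * m.+1))%:R * m.+1%:R^-1.
have KE m : (K * m.+1)%N%:R * m.+1%:R^-1 = K%:R :> R.
  by rewrite natrM mulfK// pnatr_eq0.
have gK m : g m <= K%:R.
  by rewrite -(KE m) /g ler_pM2r ?invr_gt0// ler_nat grid_exit_leq.
have lb m : capped_exit <= g m.
  apply: capped_exit_lb; rewrite /g /grid_exit.
  have [hasp|/hasNfind ->] := boolP (has (p m) (iota 0 (K * m.+1))).
    left; split; first by rewrite mulr_ge0.
    have := nth_find 0%N hasp; rewrite nth_iota ?add0n//.
    by rewrite -[X in (_ < X)%N](size_iota 0) -has_find.
  by right; rewrite size_iota KE.
apply/cvgrPdist_le => e e0.
have [s es slt] := inf_adherent e0 inf_exit.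
suff H : \forall m \near \oo, g m <= s.
  near=> m; rewrite distrC -/(g m) ger0_norm ?subr_ge0 ?lb// lerBlDl.
  by rewrite (le_trans _ (ltW slt))//; near: m.
case: es slt => [[s0 xs] slt|-> _]; last by near=> m.
have [Ks|sK] := leP K%:R s; first by near=> m; exact: le_trans Ks.
have bs := path_cvg bc (fun n => grid_ge0 0 n s) s0 (cvg_grid (leq0n 1) s0).
have H : \forall m \near \oo, x < b (grid 0 m s) by exact: (cvgr_gt (b s) bs).
near=> m; apply: le_trans (grid_le m s0).
rewrite /g /grid addn0 ler_pM2r ?invr_gt0// ler_nat leqNgt; apply/negP => jlt.
have := before_find 0%N jlt; rewrite nth_iota ?add0n.
  move=> /negbT/negP; apply; near: m; move: H; apply: filterS => m; rewrite /grid addn0; exact.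
exact: (leq_trans jlt (grid_exit_leq b x m.+1%:R^-1 (K * m.+1))).
Unshelve. all: by end_near. Qed.

Lemma cvg_stopped_wald theta :
  stopped_wald theta b x m.+1%:R^-1 (K * m.+1) @[m --> \oo] -->
  wald theta capped_exit (b capped_exit).
Proof.
rewrite /stopped_wald /wald.
have ge m : 0 <= (grid_exit b x m.+1%:R^-1 (K * m.+1))%:R * m.+1%:R^-1 :> R by rewrite mulr_ge0.
have bs := path_cvg bc ge capped_exit_ge0 cvg_grid_exit.
apply: continuous_cvg; first exact: continuous_expR.
apply: cvgB; first by apply: cvgM; [exact: cvg_cst|exact: bs].
by apply: cvgM; [exact: cvg_cst|exact: cvg_grid_exit].
Qed.

End capped_exit.

(** * The law of the first passage time *)

Lemma is_derive_cvg_seq {R : realType} (f : R -> R) (a df : R) : is_derive a 1 f df ->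
  (f (a + n.+1%:R^-1) - f a) * n.+1%:R @[n --> \oo] --> df.
Proof.
move=> [fa fE].
have cf : (fun h => h^-1 *: (f (h *: 1 + a) - f a)) @ 0^' --> df by rewrite -fE; exact: fa.
rewrite (_ : (fun n => _) = (fun h => h^-1 *: (f (h *: 1 + a) - f a)) \o (fun n : nat => n.+1%:R^-1)).
  move=> U /cf [e /= e0 eU].
  have /cvgrPdist_lt/(_ e e0)[M _ HM] := @cvg_harmonic R.
  exists M => // n Mn; apply: eU; first exact: HM.
  by rewrite invr_eq0 pnatr_eq0.
by apply/funext => n /=; rewrite invrK /GRing.scale/= mulr1 mulrC (addrC a).
Qed.

Section passage_time_law.
Context d (T : measurableType d) (R : realType) (P : probability T R).
Implicit Types (s t x y theta mu : R).

(* Uniform integrability: [W <= min(W, C) + W ^ 2 / C]. *)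
Lemma expectation_one_limit (W_ : nat -> T -> R) (L : T -> R) (C0 C1 : R) :
  (forall m, measurable_fun setT (W_ m)) -> (forall m w, 0 <= W_ m w) ->
  (forall m, \int[P]_w (W_ m w)%:E = 1)%E ->
  (forall m, \int[P]_w (W_ m w ^+ 2)%:E <= C1%:E)%E ->
  (forall w, W_ ^~ w @ \oo --> L w) -> (forall w, 0 <= L w <= C0) ->
  (\int[P]_w (L w)%:E = 1)%E.
Proof.
move=> mW W0 EW EW2 WL LC.
have mL : measurable_fun setT L.
  by apply: (measurable_fun_cvg mW) => w _; exact: WL.
have mmin C m : measurable_fun setT (fun w => Num.min (W_ m w) C).
  by apply: measurable_minr.
have cmin C : 0 <= C -> C0 < C ->
    (\int[P]_w (Num.min (W_ m w) C)%:E)%E @[m --> \oo] --> (\int[P]_w (L w)%:E)%E.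
  move=> C00 CC; apply: (@bounded_cvg_expectation _ _ _ _ _ _ C) => //.
    apply: aeW => w; have /andP[_ LC0] := LC w.
    apply: cvg_trans (WL w); apply: near_eq_cvg; near=> m.
    rewrite min_l// ltW//; near: m.
    by apply: (cvgr_lt (L w) (WL w)); exact: le_lt_trans CC.
  move=> m w; rewrite ger0_norm; first by rewrite ge_min lexx orbT.
  by rewrite le_min W0.
apply/eqP; rewrite eq_le; apply/andP; split.
  have C'0 : 0 <= Num.max 0 (C0 + 1) by rewrite le_max lexx.
  have C'C : C0 < Num.max 0 (C0 + 1) by rewrite lt_max ltrDl ltr01 orbT.
  apply: (cvge_to_le (cmin _ C'0 C'C)); apply: nearW => m.
  rewrite -(EW m); apply: ge0_le_integral => //.
  - by move=> w _; rewrite lee_fin le_min W0.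
  - exact/measurable_EFinP.
  - exact/measurable_EFinP.
  - by move=> w _; rewrite lee_fin ge_min lexx.
apply/lee_addgt0Pr => e e0.
(* [C0 + 1] makes the truncation inactive in the limit, [C1 / e] makes the tail at most [e], and 1
   makes [C] positive. *)
pose C := Num.max 1 (Num.max (C0 + 1) (`|C1| / e)).
have C1' : 1 <= C by rewrite le_max lexx.
have Cpos : 0 < C by rewrite (lt_le_trans _ C1').
have CC : C0 < C by rewrite !lt_max ltrDl ltr01 orbT.
have C1C : C1 / C <= e.
  rewrite ler_pdivrMr// mulrC -ler_pdivrMr//.
  by rewrite (le_trans _ (_ : `|C1| / e <= C)) ?ler_pM2r ?invr_gt0 ?ler_norm// !le_max lexx !orbT.
have -> : (\int[P]_w (L w)%:E + e%:E = e%:E + \int[P]_w (L w)%:E)%E by rewrite addeC.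
have cE : (e%:E + \int[P]_w (Num.min (W_ m w) C)%:E)%E @[m --> \oo] -->
    (e%:E + \int[P]_w (L w)%:E)%E.
  apply: cvgeD; [by rewrite fin_num_adde_defr|exact: cvg_cst|].
  exact: (cmin C (ltW Cpos) CC).
apply: (cvge_to_ge cE); apply: nearW => m.
have mW2 : measurable_fun setT (fun w => (W_ m w ^+ 2)%:E).
  by apply/measurable_EFinP; exact: measurable_funX.
have mmin' : measurable_fun setT (fun w => (Num.min (W_ m w) C)%:E).
  exact/measurable_EFinP.
have e1 : (\int[P]_w ((C^-1)%:E * (W_ m w ^+ 2)%:E) <= e%:E)%E.
  rewrite ge0_integralZl//; last 2 first.
  - by move=> w _; rewrite lee_fin sqr_ge0.
  - by rewrite lee_fin invr_ge0 ltW.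
  apply: (@le_trans _ _ ((C^-1)%:E * C1%:E)%E).
    by rewrite lee_wpmul2l// lee_fin invr_ge0 ltW.
  by rewrite -EFinM lee_fin mulrC.
apply: le_trans (leeD2r _ e1).
have n1 w : setT w -> (0 <= (C^-1)%:E * (W_ m w ^+ 2)%:E)%E.
  by rewrite -EFinM lee_fin mulr_ge0 ?invr_ge0 ?(ltW Cpos) ?sqr_ge0.
have n2 w : setT w -> (0 <= (Num.min (W_ m w) C)%:E)%E by rewrite lee_fin le_min W0 ltW.
have me1 : measurable_fun setT (fun w => (C^-1)%:E * (W_ m w ^+ 2)%:E)%E.
  exact: emeasurable_funM.
rewrite -ge0_integralD//.
rewrite -(EW m); apply: ge0_le_integral => //.
- by move=> w _; rewrite lee_fin.
- exact/measurable_EFinP.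
- by apply: emeasurable_funD => //; exact: emeasurable_funM.
move=> w _; rewrite -EFinM -EFinD lee_fin.
have [WC|CW] := leP (W_ m w) C.
  by rewrite lerDr mulr_ge0 ?invr_ge0 ?(ltW Cpos) ?sqr_ge0.
rewrite (le_trans (_ : _ <= C^-1 * W_ m w ^+ 2)) ?lerDl ?(ltW Cpos)//.
by rewrite mulrC ler_pdivlMr// expr2 ler_wpM2l// ltW.
Unshelve. all: by end_near. Qed.

Variable B : R -> T -> R.
Hypothesis BM : standard_brownian_motion P B.

Let mB t : 0 <= t -> measurable_fun setT (B t).
Proof. exact: (bm_measurable BM). Qed.

Let B0 w : B 0 w = 0. Proof. exact: (bm_start BM). Qed.

Let Bc w : {within `[0, +oo[%classic, continuous (fun t => B t w)}.
Proof. exact: (@bm_continuous _ _ _ _ _ BM w). Qed.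

(** The horizon bounds the second moments uniformly in the mesh, and [capped_exit_val] bounds the
    limit, so the value 1 survives refinement. *)
Lemma expectation_capped_wald theta x (K : nat) : 0 < theta -> 0 <= x ->
  (\int[P]_w (wald theta (capped_exit (B^~ w) x K) (B (capped_exit (B^~ w) x K) w))%:E = 1)%E.
Proof.
move=> t0 x0.
have h0 (m : nat) : 0 < m.+1%:R^-1 :> R by rewrite invr_gt0.
have hn (m j : nat) : 0 <= j%:R * m.+1%:R^-1 :> R by rewrite mulr_ge0.
apply: (@expectation_one_limit (fun m w => stopped_wald theta (B^~ w) x m.+1%:R^-1 (K * m.+1))
  _ (expR (theta * x)) (expR (theta ^+ 2 * K%:R))).
- by move=> m; apply: measurable_stopped_wald => j _; exact: mB.
- by move=> m w; exact: expR_ge0.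
- by move=> m; exact: (expectation_stopped_wald BM).
- move=> m; apply: (expectation_stopped_wald_sqr BM) => //.
  by rewrite natrM mulfK// pnatr_eq0.
- by move=> w; exact: (@cvg_stopped_wald _ _ _ _ (@Bc w) theta).
- move=> w; rewrite expR_ge0 ler_expR /= lerBlDr.
  rewrite (@le_trans _ _ (theta * x))//.
    by rewrite ler_pM2l//; exact: (capped_exit_val _ (B0 w) (@Bc w) x0).
  by rewrite lerDl mulr_ge0 ?divr_ge0 ?sqr_ge0// capped_exit_ge0.
Qed.


Let T_ x w := hitting (B^~ w) x.
Let hit x (K : nat) := [set w | reached (B^~ w) x K%:R].
Let hits x := \bigcup_K hit x K.

Let mhit x K : measurable (hit x K).
Proof. exact: (measurable_reached (X := fun=> x) (@Bc) mB). Qed.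

Let mhits x : measurable (hits x).
Proof. exact: bigcupT_measurable. Qed.

Let mT x : 0 <= x -> measurable_fun setT (T_ x).
Proof.
by move=> x0; exact: (measurable_first_passage B0 (@Bc) mB (X := fun=> x)).
Qed.

Let hit_homo x K K' w : (K <= K')%N -> hit x K w -> hit x K' w.
Proof.
move=> KK' [r /andP[r0 rK] xr]; exists r => //.
by rewrite r0 (le_trans rK)// ler_nat.
Qed.

Let mexp mu (f : T -> R) : measurable_fun setT f ->
  measurable_fun setT (fun w => expR (- mu * f w)).
Proof.
move=> mf; apply: (measurableT_comp (@measurable_expR R)); exact: measurable_funM.
Qed.

Let exp_le1 mu t : 0 <= mu -> 0 <= t -> expR (- mu * t) <= 1.
Proof. by move=> m0 t0; rewrite -[leRHS]expR0 ler_expR mulNr oppr_le0 mulr_ge0. Qed.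

(* The grid does not see a path that only touches a level, so refining it gives
   the exit time strictly above the level; the hitting time of [x] lies between
   the exit times above [y < x] and above [x]. *)
Lemma laplace_hitting_hits theta x : 0 < theta -> 0 < x ->
  (\int[P]_w (\1_(hits x) w * expR (- (theta ^+ 2 / 2) * T_ x w))%:E =
   (expR (- theta * x))%:E)%E.
Proof.
move=> t0 x0; set mu := theta ^+ 2 / 2.
have mu0 : 0 < mu by rewrite divr_gt0 ?exprn_gt0.
have T0 w : 0 <= T_ x w by exact: hitting_ge0.
(* The indicator removes the paths that never reach [x], where [T_ x] is 0 by convention. *)
pose Phi w : R := \1_(hits x) w * expR (- mu * T_ x w).
have mPhi : measurable_fun setT Phi.
  by apply: measurable_funM; [exact: measurable_indic|apply: mexp; exact/mT/ltW].
pose f K w : R := \1_(hit x K) w * expR (- mu * T_ x w).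
pose g (K : nat) : R := expR (- mu * K%:R).
have mf K : measurable_fun setT (f K).
  by apply: measurable_funM; [exact: measurable_indic|apply: mexp; exact/mT/ltW].
have fPhi w : f ^~ w @ \oo --> Phi w.
  rewrite /f /Phi; have [[K _ hK]|nh] := pselect (hits x w).
    apply: cvg_near_cst; exists K => // K' /= KK'.
    by rewrite !indicE !mem_set//; [exists K|exact: hit_homo hK].
  apply: cvg_near_cst; apply: nearW => K.
  by rewrite !indicE !memNset// => hK; apply: nh; exists K.
have f01 K w : 0 <= f K w <= 1.
  by rewrite mulr_ge0 ?expR_ge0//= mulr_ile1 ?expR_ge0 ?exp_le1 ?(ltW mu0)// indicE; case: (_ \in _).
have If : (\int[P]_w (f K w)%:E)%E @[K --> \oo] --> (\int[P]_w (Phi w)%:E)%E.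
  apply: (@bounded_cvg_expectation _ _ _ _ _ _ 1) => //; first exact: aeW.
  by move=> K w; have /andP[? ?] := f01 K w; rewrite ger0_norm.
have g0 : g @ \oo --> 0.
  rewrite /g; have -> : (fun K : nat => expR (- mu * K%:R)) = (fun K => expR (- mu) ^+ K).
    by apply/funext => K; rewrite mulrC expRM_natl.
  apply: cvg_expr; rewrite ger0_norm ?expR_ge0//.
  by rewrite -[ltRHS]expR0 ltr_expR oppr_lt0.
apply/eqP; rewrite eq_le; apply/andP; split.
  have yx (n : nat) : 0 <= x * (1 - n.+1%:R^-1) < x.
    have V0 : 0 < n.+1%:R^-1 :> R by rewrite invr_gt0.
    have V1 : n.+1%:R^-1 <= 1 :> R by rewrite invf_le1 ?ltr0n// ler1n.
    by rewrite mulr_ge0 ?(ltW x0) ?subr_ge0//= gtr_pMr// ltrBlDr ltrDl.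
  (* Upper bound: a path hitting [x] before [K] leaves a lower level [y] earlier, at height at least
     [y]. Afterwards [y] increases to [x]. *)
  have B2 n : (\int[P]_w (Phi w)%:E <= (expR (- theta * (x * (1 - n.+1%:R^-1))))%:E)%E.
    have /andP[y0 yltx] := yx n; set y := x * _ in y0 yltx *.
    apply: (cvge_to_le If); apply: nearW => K.
    pose L w := wald theta (capped_exit (B^~ w) y K) (B (capped_exit (B^~ w) y K) w).
    have EL : (\int[P]_w (L w)%:E = 1)%E by exact: expectation_capped_wald.
    have L0 w : 0 <= L w by exact: expR_ge0.
    have fL w : f K w <= expR (- theta * y) * L w.
      rewrite /f indicE; case: (pselect (hit x K w)) => hK; last first.
        by rewrite memNset// mul0r mulr_ge0 ?expR_ge0.
      rewrite mem_set// mul1r -expRD ler_expR !mulNr.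
      have [H1 H2] := capped_exit_le_hitting (B0 w) (@Bc w) y0 yltx hK.
      rewrite -(ler_pM2l t0) in H2; rewrite -(ler_pM2l mu0) in H1.
      by move: H1 H2; rewrite /T_ /mu; lra.
    have mL : measurable_fun setT L.
      apply: (@measurable_fun_cvg _ _ _ setT (fun m w => stopped_wald theta (B^~ w) y m.+1%:R^-1 (K * m.+1))).
        by move=> m; apply: measurable_stopped_wald => j _; apply: mB; rewrite mulr_ge0.
      by move=> w _; exact: (@cvg_stopped_wald _ _ _ _ (@Bc w) theta).
    rewrite -[leRHS]mule1 -EL -ge0_integralZl//; last 2 first.
    - exact/measurable_EFinP.
    - by move=> w _; rewrite lee_fin L0.
    apply: ge0_le_integral => //.
    - by move=> w _; rewrite lee_fin; have /andP[] := f01 K w.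
    - exact/measurable_EFinP.
    - by apply: emeasurable_funM => //; exact/measurable_EFinP.
    - by move=> w _; rewrite -EFinM lee_fin.
  have cy : (expR (- theta * (x * (1 - n.+1%:R^-1))))%:E @[n --> \oo] --> (expR (- theta * x))%:E.
    apply: cvg_EFin; first exact: nearW.
    apply: continuous_cvg; first exact: continuous_expR.
    apply: cvgM; first exact: cvg_cst.
    rewrite -[X in _ --> X]mulr1 -[X in _ * X]subr0.
    apply: cvgM; first exact: cvg_cst.
    by apply: cvgB; [exact: cvg_cst|exact: cvg_harmonic].
  by apply: (cvge_to_ge cy); exact: nearW.
(* Lower bound: paths that miss [x] before [K] have exit time at least [K], so the added term [g K]
   accounts for them; it vanishes as [K] grows. *)
pose G K w : R := f K w + \1_(~` hit x K) w * g K.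
have mG K : measurable_fun setT (G K).
  apply: measurable_funD => //; apply: measurable_funM => //; apply: measurable_indic.
  exact: measurableC.
have g01 K : 0 <= g K <= 1 by rewrite expR_ge0 exp_le1// ltW.
have G02 K w : 0 <= G K w <= 2.
  have /andP[f0 f1] := f01 K w; have /andP[g0' g1] := g01 K.
  rewrite addr_ge0 ?mulr_ge0//= -[leRHS]/(1 + 1) lerD//.
  by rewrite mulr_ile1// indicE; case: (_ \in _).
have GPhi w : G ^~ w @ \oo --> Phi w.
  rewrite -[X in _ --> X]addr0; apply: cvgD; first exact: fPhi.
  have gg : (fun=> 0 : R) @ \oo --> (0 : R) by exact: cvg_cst.
  apply: (squeeze_cvgr _ gg g0); apply: nearW => K.
  have /andP[g0' g1] := g01 K.
  by rewrite mulr_ge0//= ler_piMl// indicE; case: (_ \in _).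
have IG : (\int[P]_w (G K w)%:E)%E @[K --> \oo] --> (\int[P]_w (Phi w)%:E)%E.
  apply: (@bounded_cvg_expectation _ _ _ _ _ _ 2) => //; first exact: aeW.
  by move=> K w; have /andP[? ?] := G02 K w; rewrite ger0_norm.
apply: (cvge_to_ge IG); apply: nearW => K.
pose L w := wald theta (capped_exit (B^~ w) x K) (B (capped_exit (B^~ w) x K) w).
have EL : (\int[P]_w (L w)%:E = 1)%E by apply: expectation_capped_wald => //; exact: ltW.
have L0 w : 0 <= L w by exact: expR_ge0.
have mL : measurable_fun setT L.
  apply: (@measurable_fun_cvg _ _ _ setT (fun m w => stopped_wald theta (B^~ w) x m.+1%:R^-1 (K * m.+1))).
    by move=> m; apply: measurable_stopped_wald => j _; apply: mB; rewrite mulr_ge0.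
  by move=> w _; exact: (@cvg_stopped_wald _ _ _ _ (@Bc w) theta).
have fL w : expR (- theta * x) * L w <= G K w.
  have H1 : theta * B (capped_exit (B^~ w) x K) w <= theta * x.
    by rewrite ler_pM2l//; exact: (capped_exit_val _ (B0 w) (@Bc w) (ltW x0)).
  rewrite /G /f /L /wald -expRD !indicE; case: (pselect (hit x K w)) => hK.
    rewrite mem_set// memNset; last by move=> /(_ hK).
    rewrite mul1r mul0r addr0 ler_expR !mulNr.
    have H2 := capped_exit_ge_hitting (B0 w) (@Bc w) (ltW x0) hK.
    by rewrite -(ler_pM2l mu0) in H2; move: H1 H2; rewrite /T_ /mu; lra.
  rewrite memNset// mem_set// mul1r mul0r add0r ler_expR !mulNr.
  have H2 := capped_exit_ge_horizon hK.
  by rewrite -(ler_pM2l mu0) in H2; move: H1 H2; rewrite /mu; lra.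
rewrite -[leLHS]mule1 -EL -ge0_integralZl//; last 2 first.
- exact/measurable_EFinP.
- by move=> w _; rewrite lee_fin L0.
apply: ge0_le_integral => //.
- by move=> w _; rewrite -EFinM lee_fin mulr_ge0 ?expR_ge0.
- by apply: emeasurable_funM => //; exact/measurable_EFinP.
- exact/measurable_EFinP.
- by move=> w _; rewrite -EFinM lee_fin.
Qed.

(** Let [theta] tend to 0 in the Laplace transform: the left side tends to the probability, the
    right side to 1. *)
Lemma probability_hits x : 0 < x -> (P (hits x) = 1)%E.
Proof.
move=> x0; pose theta (n : nat) : R := n.+1%:R^-1.
have t0 n : 0 < theta n by rewrite invr_gt0.
have T0 w : 0 <= T_ x w by exact: hitting_ge0.
pose Phi n w : R := \1_(hits x) w * expR (- (theta n ^+ 2 / 2) * T_ x w).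
have mI : measurable_fun setT (\1_(hits x) : T -> R) by exact: measurable_indic.
have mPhi n : measurable_fun setT (Phi n).
  by apply: measurable_funM => //; apply: mexp; exact/mT/ltW.
have tn : theta @ \oo --> (0 : R) by exact: cvg_harmonic.
have c1 : (\int[P]_w (Phi n w)%:E)%E @[n --> \oo] --> (\int[P]_w (\1_(hits x) w)%:E)%E.
  apply: (@bounded_cvg_expectation _ _ _ _ _ _ 1) => //.
    apply: aeW => w; rewrite /Phi -[X in _ --> X]mulr1.
    apply: cvgM; first exact: cvg_cst.
    rewrite -[X in _ --> X]expR0; apply: continuous_cvg; first exact: continuous_expR.
    rewrite [X in _ --> X](_ : 0 = - (0 * 0 / 2) * T_ x w); last by rewrite !mul0r oppr0 mul0r.
    apply: cvgM; last exact: cvg_cst.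
    by apply: cvgN; apply: cvgM; [exact: cvgM|exact: cvg_cst].
  move=> n w; rewrite ger0_norm ?mulr_ge0 ?expR_ge0// mulr_ile1 ?expR_ge0//.
  by rewrite exp_le1// divr_ge0 ?sqr_ge0.
have c2 : (\int[P]_w (Phi n w)%:E)%E @[n --> \oo] --> (1%:E)%E.
  rewrite (_ : (fun n => _) = (fun n => (expR (- theta n * x))%:E)); last first.
    by apply/funext => n; rewrite laplace_hitting_hits.
  apply: cvg_EFin; first exact: nearW.
  rewrite -[X in _ --> X]expR0; apply: continuous_cvg; first exact: continuous_expR.
  rewrite [X in _ --> X](_ : 0 = - 0 * x); last by rewrite oppr0 mul0r.
  by apply: cvgM; [exact: cvgN|exact: cvg_cst].
have : (\int[P]_w (\1_(hits x) w)%:E = 1)%E by exact: (cvg_unique _ c1 c2).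
by rewrite integral_indic// setIT.
Qed.

(** Integer levels suffice, [reached] being monotone in the level; this gives one null set for all
    levels. *)
Lemma ae_reached : {ae P, forall w, forall x, exists t, reached (B^~ w) x t}.
Proof.
have H (n : nat) : {ae P, forall w, exists t, reached (B^~ w) n.+1%:R t}.
  exists (~` hits n.+1%:R); split.
  - exact: measurableC.
  - have [mh Ph] : measurable (hits n.+1%:R) /\ P (hits n.+1%:R) = 1%E.
      by split => //; exact: probability_hits.
    by rewrite probability_setC// Ph subee.
  - by move=> w /= nr [K _ hK]; apply: nr; exists K%:R.
have := ae_foralln H; apply: filterS => w Hw x.
have [t [r rt xr]] := Hw (Num.truncn x); exists t, r => //.
by rewrite (le_trans _ xr)// ltW// truncnS_gt.
Qed.

Let T0E w : T_ 0 w = 0.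
Proof.
by apply/eqP; rewrite eq_le hitting_ge0 andbT; apply: hitting_lb; rewrite ?lexx.
Qed.

Lemma laplace_hitting theta x : 0 < theta -> 0 <= x ->
  (\int[P]_w (expR (- (theta ^+ 2 / 2) * T_ x w))%:E = (expR (- theta * x))%:E)%E.
Proof.
move=> t0; rewrite le_eqVlt => /predU1P[<-|x0].
  rewrite (eq_integral (fun=> 1%E)); last by move=> w _; rewrite T0E mulr0 expR0.
  by rewrite integral_cst// mul1e mulr0 expR0; exact: probability_setT.
rewrite -laplace_hitting_hits//; apply: ae_eq_integral => //.
- by apply/measurable_EFinP; apply: mexp; exact/mT/ltW.
- apply/measurable_EFinP; apply: measurable_funM; first exact: measurable_indic.
  by apply: mexp; exact/mT/ltW.
- have := ae_reached; apply: filterS => w /(_ x)[t [r /andP[r0 rt] xr]] _.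
  rewrite indicE mem_set ?mul1r//; exists (Num.truncn r).+1 => //.
  by exists r => //; rewrite r0 ltW// truncnS_gt.
Qed.

(** Differentiation in [q] under the expectation: the difference quotients between [q] and [q_ i]
    converge to [q] times the next power on one side and, by [is_derive_passage_moment_rate], to [q]
    times the next moment on the other. *)
Lemma expectation_exppoly_passage m q x : 0 < q -> 0 <= x ->
  (\int[P]_w (exppoly m (q ^+ 2 / 2) (first_passage B x w))%:E = (passage_moment m q x)%:E)%E.
Proof.
move=> q0 x0; rewrite -/(T_ x).
elim: m q q0 => [|m IH] q q0.
  by rewrite -laplace_hitting//; apply: eq_integral => w _; rewrite /exppoly expr0 mul1r.
have T0 w : 0 <= T_ x w by exact: hitting_ge0.
have mu0 r : 0 < r -> 0 < r ^+ 2 / 2 by move=> r0; rewrite divr_gt0 ?exprn_gt0.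
have me k r : measurable_fun setT (fun w => exppoly k r (T_ x w)).
  apply: measurable_funM; first by apply: measurable_funX; exact: mT.
  by apply: mexp; exact: mT.
have me' k r : measurable_fun setT (fun w => (exppoly k r (T_ x w))%:E).
  exact/measurable_EFinP.
pose q_ (i : nat) := q + i.+1%:R^-1.
have i0 (i : nat) : 0 < i.+1%:R^-1 :> R by rewrite invr_gt0.
have q_0 i : 0 < q_ i by rewrite addr_gt0.
pose F i w := (exppoly m (q ^+ 2 / 2) (T_ x w) - exppoly m (q_ i ^+ 2 / 2) (T_ x w)) * i.+1%:R.
have mF i : measurable_fun setT (F i).
  by apply: measurable_funM => //; exact: measurable_funB.
have Fbnd i w : 0 <= F i w <= (q + 1) * exppoly m.+1 (q ^+ 2 / 2) (T_ x w).
  rewrite /F /exppoly; set t := T_ x w; have t0 : 0 <= t by exact: T0.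
  have i1 : i.+1%:R^-1 <= 1 :> R by rewrite invf_le1 ?ltr0n// ler1n.
  (* The difference of the exponents at [q_ i] and [q]; the inequality [1 - expR (- y) <= y] then
     dominates the quotients. *)
  pose y := (q + i.+1%:R^-1 / 2) * t * i.+1%:R^-1.
  have y0 : 0 <= y by rewrite !mulr_ge0// addr_ge0 ?divr_ge0 ?(ltW q0).
  have -> : - (q_ i ^+ 2 / 2) * t = - (q ^+ 2 / 2) * t + - y by rewrite /y /q_; field; rewrite nat1r pnatr_eq0.
  rewrite expRD -[X in (X - _) * _]mulr1 mulrA -mulrBr.
  have ey1 : 1 - expR (- y) <= y by have := expR_ge1Dx (- y); lra.
  have ey0 : 0 <= 1 - expR (- y) by rewrite subr_ge0 -[leRHS]expR0 ler_expR oppr_le0.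
  have e0 : 0 <= t ^+ m * expR (- (q ^+ 2 / 2) * t) by rewrite mulr_ge0 ?exprn_ge0 ?expR_ge0.
  apply/andP; split; first by rewrite mulr_ge0// mulr_ge0.
  rewrite [leRHS](_ : _ = t ^+ m * expR (- (q ^+ 2 / 2) * t) * ((q + 1) * t)); last first.
    by rewrite exprS; ring.
  move: e0; move: (t ^+ m * _) => E E0.
  rewrite -mulrA ler_wpM2l// -ler_pdivlMr ?ltr0n// (le_trans ey1)// /y.
  rewrite ler_pM2r// ler_wpM2r// lerD2l.
  by rewrite ler_pdivrMr// (le_trans i1)//; lra.
have c1 : (\int[P]_w (F i w)%:E)%E @[i --> \oo] -->
    (\int[P]_w (q * exppoly m.+1 (q ^+ 2 / 2) (T_ x w))%:E)%E.
  apply: (@bounded_cvg_expectation _ _ _ _ _ _ ((q + 1) * (m.+2%:R / (q ^+ 2 / 2)) ^+ m.+1)) => //.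
  - exact: measurable_funM.
  - apply: aeW => w; set t := T_ x w.
    have := is_derive_lamZ (t ^+ m) (is_derive1_comp (is_derive_expR _) (is_derive_lamZ (- t / 2) (is_derive_lamXn 2 q))).
    move=> /is_derive_cvg_seq/cvgN; rewrite /F -/t.
    rewrite [X in _ --> X -> _](_ : _ = q * exppoly m.+1 (q ^+ 2 / 2) t).
      apply: cvg_trans; apply: near_eq_cvg; apply: nearW => i.
      rewrite /exppoly /= -mulNr opprB /q_.
      by congr ((_ * expR _ - _ * expR _) * _); field.
    have -> : - t / 2 * q ^+ 2 = - (q ^+ 2 / 2) * t by field.
    by rewrite /exppoly (exprS t m) /= expr1; field.
  - move=> i w; have /andP[F0 Fle] := Fbnd i w; rewrite ger0_norm//.
    by rewrite (le_trans Fle)// ler_wpM2l ?addr_ge0 ?(ltW q0)// exppoly_le ?mu0.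
have EF i : (\int[P]_w (F i w)%:E = ((passage_moment m q x - passage_moment m (q_ i) x) * i.+1%:R)%:E)%E.
  have F0 w : setT w -> (0 <= (F i w)%:E)%E by rewrite lee_fin; have /andP[] := Fbnd i w.
  have mF' : measurable_fun setT (fun w => (F i w)%:E) by exact/measurable_EFinP.
  have e0 k r w : setT w -> (0 <= (exppoly k r (T_ x w))%:E)%E.
    by rewrite lee_fin exppoly_ge0.
  have e0' k r w : setT w -> (0 <= (i.+1%:R)%:E * (exppoly k r (T_ x w))%:E)%E.
    by rewrite -EFinM lee_fin mulr_ge0 ?exppoly_ge0.
  have me'' k r : measurable_fun setT (fun w => (i.+1%:R)%:E * (exppoly k r (T_ x w))%:E)%E.
    exact: emeasurable_funM.
  (* Stated as a sum, so that additivity for nonnegative integrands applies. *)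
  have : (\int[P]_w (F i w)%:E + (i.+1%:R)%:E * (passage_moment m (q_ i) x)%:E =
      (i.+1%:R)%:E * (passage_moment m q x)%:E)%E.
    have IH' r (r0 : 0 < r) : (\int[P]_w (exppoly m (r ^+ 2 / 2) (T_ x w))%:E =
        (passage_moment m r x)%:E)%E := IH r r0.
    rewrite -(IH' _ (q_0 i)) -(IH' _ q0).
    rewrite -(ge0_integralZl _ measurableT (me' _ _) (e0 _ _))//.
    rewrite -(ge0_integralZl _ measurableT (me' _ _) (e0 _ _))//.
    rewrite -(ge0_integralD _ measurableT F0 mF' (e0' _ _) (me'' _ _)).
    by apply: eq_integral => w _; rewrite -!EFinM -EFinD /F; congr EFin; ring.
  rewrite -!EFinM => H.
  rewrite mulrBl EFinB [X in (X - _)%E](_ : _ = (i.+1%:R * passage_moment m q x)%:E); last by rewrite mulrC.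
  by rewrite -H [in RHS]mulrC addeK.
have c2 : (\int[P]_w (F i w)%:E)%E @[i --> \oo] --> ((q * passage_moment m.+1 q x)%:E)%E.
  under eq_fun do rewrite EF.
  apply: cvg_EFin; first exact: nearW.
  have /is_derive_cvg_seq/cvgN := is_derive_passage_moment_rate m x q0.
  rewrite mulNr opprK; apply: cvg_trans; apply: near_eq_cvg; apply: nearW => i /=.
  by rewrite -mulNr opprB.
have : (\int[P]_w (q * exppoly m.+1 (q ^+ 2 / 2) (T_ x w))%:E = (q * passage_moment m.+1 q x)%:E)%E.
  exact: (cvg_unique _ c1 c2).
under eq_integral do rewrite EFinM.
rewrite ge0_integralZl//; last 2 first.
- by move=> w _; rewrite lee_fin exppoly_ge0.
- by rewrite lee_fin ltW.
move=> /(congr1 (fun z => (q^-1)%:E * z)%E).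
by rewrite muleA -!EFinM mulVf ?gt_eqF// mul1e mulKf ?gt_eqF.
Qed.

End passage_time_law.

(** * The iterated process *)

Section iterated_passage.
Context d (T : measurableType d) (R : realType) (P : probability T R).
Variables (lambda : nat -> R) (N : R -> T -> nat) (n : nat) (B : 'I_n -> R -> T -> R).
Hypothesis birthN : pure_birth_process P lambda N.
Hypothesis brownianB : forall j, standard_brownian_motion P (B j).
Hypothesis indepBN : mutual_independence P (joint_sigma B N).
Implicit Types (t x : R) (l : seq 'I_n) (f F g G : R -> R).

Definition passage_along l t w := foldr (fun j x => first_passage (B j) x w) t l.

Lemma passage_along_ge0 l t w : 0 <= t -> 0 <= passage_along l t w.
Proof. by case: l => //= j l _; exact: hitting_ge0. Qed.

(** The map [i] allows [T] to be given the smaller sigma-algebra generated by the motions in [l],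
    from which independence is read off. *)
Lemma measurable_passage_along d' (T' : measurableType d') (i : T' -> T) l t : 0 <= t ->
  (forall j, j \in l -> forall s, 0 <= s -> measurable_fun setT (B j s \o i)) ->
  measurable_fun setT (passage_along l t \o i).
Proof.
move=> t0; elim: l => [|j l IH] mB; first exact: measurable_cst.
have mX : measurable_fun setT (passage_along l t \o i).
  by apply: IH => k kl; apply: mB; rewrite in_cons kl orbT.
apply: (@measurable_first_passage _ _ _ (fun s => B j s \o i) _ _ _ (passage_along l t \o i)) => //.
- by move=> w; exact: (bm_start (brownianB j)).
- by move=> w; exact: (@bm_continuous _ _ _ _ _ (brownianB j)).
- by move=> s s0; apply: mB => //; rewrite mem_head.
- by move=> w; exact: passage_along_ge0.
Qed.

Lemma measurable_passage_alongT l t : 0 <= t -> measurable_fun setT (passage_along l t).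
Proof.
move=> t0; apply: (@measurable_passage_along _ T idfun) => // j _ s s0.
exact: (bm_measurable (brownianB j)).
Qed.

Let joint_measurable o : joint_sigma B N o `<=` measurable.
Proof.
case: o => [j|] /=; apply: smallest_sub; try exact: sigma_algebra_measurable.
  move=> _ [t [V [t0 mV ->]]]; rewrite -[X in measurable X]setTI.
  by apply: (bm_measurable (brownianB j)) => //; move: t0; rewrite /= in_itv/= andbT.
move=> _ [t [V [t0 mV ->]]]; rewrite -[X in measurable X]setTI.
by apply: (pb_measurable birthN) => //; move: t0; rewrite /= in_itv/= andbT.
Qed.

Let joint_setT o : joint_sigma B N o setT.
Proof. by case: o => [j|] /=; exact: (@measurableT _ (g_sigma_algebraType _)). Qed.

Let joint_setI o : setI_closed (joint_sigma B N o).
Proof. by case: o => [j|] /= A1 A2; exact: (@measurableI _ (g_sigma_algebraType _)). Qed.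

Lemma independent_passage_along o l t A V : o \notin map Some l -> 0 <= t ->
  joint_sigma B N o A -> measurable V ->
  P (A `&` passage_along l t @^-1` V) = (P A * P (passage_along l t @^-1` V))%E.
Proof.
move=> ol t0 oA mV.
pose J : {fset option 'I_n} := [fset o' in map Some l]%fset.
have JE o' : (o' \in J)%fset = (o' \in map Some l) by rewrite !inE.
apply: (mutual_independence_family indepBN (i := o) (J := J)) => //; first by rewrite JE.
pose gens := [set A : set T | exists2 o', (o' \in J)%fset & joint_sigma B N o' A].
have := @measurable_passage_along _ (g_sigma_algebraType gens) idfun l t t0 _ measurableT V mV.
rewrite setTI; apply => j jl s s0 _ U mU; rewrite setTI.
apply: sub_sigma_algebra; exists (Some j); first by rewrite JE map_f.
by apply: sub_sigma_algebra; exists s, U; split => //; rewrite /= in_itv/= andbT.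
Qed.

Lemma integrable_exppoly_span f (Z : T -> R) : exppoly_span f ->
  measurable_fun setT Z -> (forall w, 0 <= Z w) ->
  P.-integrable setT (fun w => (f (Z w))%:E).
Proof.
move=> Vf mZ Z0; have [C C0 fC] := exppoly_span_bounded Vf.
apply: (@le_integrable _ _ _ P setT measurableT _ (cst C%:E)).
- apply/measurable_EFinP; apply: measurableT_comp mZ.
  by apply: continuous_measurable_fun; exact: exppoly_span_continuous.
- by move=> w _ /=; rewrite lee_fin (ger0_norm C0) fC.
- exact: finite_measure_integrable_cst.
Qed.

(** Given the inner level, integrating over the independent motion [B j] turns each basis function
    into its moment. The grid from below is used, passage times being left-continuous in the
    level. *)
Lemma expectation_passage_transform j l t f F : j \notin l -> 0 <= t ->
  passage_transform f F ->
  (\int[P]_w (f (first_passage (B j) (passage_along l t w) w))%:E =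
   \int[P]_w (F (passage_along l t w))%:E)%E.
Proof.
move=> jl t0.
have mX := measurable_passage_alongT l t0.
have X0 w := passage_along_ge0 l w t0.
pose Z w := first_passage (B j) (passage_along l t w) w.
have mZ : measurable_fun setT Z := @measurable_passage_alongT (j :: l) t t0.
have Z0 w : 0 <= Z w by exact: hitting_ge0.
have mcont f1 : exppoly_span f1 -> measurable_fun setT f1.
  by move=> Vf1; apply: continuous_measurable_fun; exact: exppoly_span_continuous.
elim=> [|c m q g G q0 gG IH]; first by [].
have [Vg VG] := passage_transform_span gG.
have mu0 : 0 < q ^+ 2 / 2 by rewrite divr_gt0 ?exprn_gt0.
have Ve := exppoly_span_exppoly m mu0.
have Vu := exppoly_span_passage_moment m q0.
under eq_integral do rewrite EFinD EFinM.
under [RHS]eq_integral do rewrite EFinD EFinM.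
have ie := integrable_exppoly_span Ve mZ Z0.
have iu := integrable_exppoly_span Vu mX X0.
rewrite integralD//; last 2 first.
- exact: integrableZl.
- exact: integrable_exppoly_span.
rewrite integralD//; last 2 first.
- exact: integrableZl.
- exact: integrable_exppoly_span.
rewrite !integralZl// IH; congr (_ * _ + _)%E.
apply: (@expectation_freeze _ _ _ P (passage_along l t)
  (fun x w => exppoly m (q ^+ 2 / 2) (first_passage (B j) x w))
  (fun w => exppoly m (q ^+ 2 / 2) (Z w)) (passage_moment m q)
  ((m.+1%:R / (q ^+ 2 / 2)) ^+ m) 0) => //.
- move=> x x0; apply: measurableT_comp; first exact: mcont.
  exact: (@measurable_passage_alongT [:: j] x x0).
- by move=> x w x0; rewrite exppoly_ge0 ?exppoly_le ?hitting_ge0.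
- move=> x U V x0 mU mV.
  apply: (@independent_passage_along (Some j)) => //.
    by rewrite mem_map// => ? ? [].
  have mU' : measurable (exppoly m (q ^+ 2 / 2) @^-1` U).
    by rewrite -[X in measurable X]setTI; exact: mcont.
  pose gens := [set A : set T | exists t (V : set R),
     [/\ `[0, +oo[%classic t, measurable V & A = B j t @^-1` V]].
  have := @measurable_passage_along _ (g_sigma_algebraType gens) idfun [:: j] x x0 _ measurableT _ mU'.
  rewrite setTI; apply => k; rewrite inE => /eqP -> s s0 _ W mW; rewrite setTI.
  by apply: sub_sigma_algebra; exists s, W; split => //; rewrite /= in_itv/= andbT.
- by move=> x x0; exact: expectation_exppoly_passage.
- exact: (measurableT_comp (mcont _ Ve)).
- have := ae_reached (brownianB j); apply: filterS => w /(_ (passage_along l t w))[s rs].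
  apply: continuous_cvg; first exact: exppoly_span_continuous.
  apply: (@hitting_left_continuous _ _ (bm_start (brownianB j) w)
    (@bm_continuous _ _ _ _ _ (brownianB j) w) _ _ s) => //.
    by move=> k; rewrite grid_ge0 grid_le.
  exact: cvg_grid.
- exact: (measurableT_comp (mcont _ Vu)).
- move=> x x0; apply: continuous_cvg; first exact: exppoly_span_continuous.
  exact: cvg_grid.
Qed.

(** Integrate out the motions from the outermost inwards; [uniq l] keeps each of them independent of
    the level at which it is evaluated. *)
Lemma expectation_passage_along l t f F : uniq l -> 0 <= t ->
  iter_passage_transform (size l) f F ->
  (\int[P]_w (f (passage_along l t w))%:E = (F t)%:E)%E.
Proof.
elim: l f => [|j l IH] f /=.
  move=> _ t0 [_ ->]; rewrite integral_cst// -[RHS]mule1; congr (_ * _)%E.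
  exact: probability_setT.
move=> /andP[jl ul] t0 [G fG GF]; rewrite -(IH G)//.
exact: expectation_passage_transform.
Qed.

(** Here the grid lies strictly above the time: [N] is constant just to the right of it, so the
    indicator along the grid is eventually constant. *)
Lemma birth_at_passage k l t v : 0 <= t -> exppoly_span v ->
  (forall s, 0 <= s -> state_prob P N k s = v s) ->
  P [set w | N (passage_along l t w) w = k] = (\int[P]_w (v (passage_along l t w))%:E)%E.
Proof.
move=> t0 Vv pv.
have mX := measurable_passage_alongT l t0.
have X0 w := passage_along_ge0 l w t0.
pose Y x w : R := \1_[set w | N x w = k] w.
have mNk x : 0 <= x -> measurable [set w | N x w = k] by exact: (birth_measurable birthN).
have mY x : 0 <= x -> measurable_fun setT (Y x).
  by move=> x0; apply: measurable_indic; exact: mNk.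
have YE x w : Y x w = (N x w == k)%:R.
  rewrite /Y indicE; congr (nat_of_bool _)%:R.
  by apply/idP/eqP => [|H]; rewrite inE.
have cY w : Y (grid 1 m (passage_along l t w)) w @[m --> \oo] --> Y (passage_along l t w) w.
  set x := passage_along l t w; have x0 : 0 <= x by exact: X0.
  apply: cvg_near_cst.
  have [e /= e0 eH] := pb_right_continuous birthN w x0.
  have /cvgrPdist_lt/(_ e e0) := cvg_grid (leqnn 1) x0.
  apply: filterS => m mx; rewrite !YE (eH (grid 1 m x)) ?grid_gt//.
have mYX : measurable_fun setT (fun w => Y (passage_along l t w) w).
  apply: (measurable_fun_cvg (fun m => measurable_fun_grid 1 m mX X0 mY)) => w _.
  exact: cY.
have setE : [set w | N (passage_along l t w) w = k] =
    (fun w => Y (passage_along l t w) w) @^-1` [set 1].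
  apply/seteqP; split => w /=; rewrite YE; first by move=> ->; rewrite eqxx.
  by case: eqP => // _ /eqP; rewrite eq_sym oner_eq0.
have mS : measurable [set w | N (passage_along l t w) w = k].
  by rewrite setE -[X in measurable X]setTI; exact: mYX.
transitivity (\int[P]_w (Y (passage_along l t w) w)%:E)%E.
  by rewrite -[in LHS](setIT [set w | _]) -integral_indic.
apply: (@expectation_freeze _ _ _ P (passage_along l t) Y _ v 1 1) => //.
- by move=> x w x0; rewrite YE; case: eqP; rewrite ?lexx ler01.
- move=> x U V x0 mU mV; apply: (@independent_passage_along None) => //.
    by apply/mapP => -[].
  apply: sub_sigma_algebra; exists x, [set m | U (m == k)%:R]; split => //.
    by rewrite /= in_itv/= andbT.
  by apply/funext => w; rewrite /= /preimage/= YE.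
- move=> x x0; rewrite integral_indic ?setIT; [|exact: measurableT|exact: mNk].
  by rewrite -pv//; exact/esym/(birth_probE birthN).
- by apply: aeW => w; exact: cY.
- by apply: measurableT_comp mX; apply: continuous_measurable_fun; exact: exppoly_span_continuous.
- move=> x x0; apply: continuous_cvg; first exact: exppoly_span_continuous.
  exact: cvg_grid.
Qed.

End iterated_passage.

(** Agreement on the open half-line is agreement near each of its points, which determines
    derivatives of every order. *)
Lemma derive1n_eq_on_pos {R : realType} (f g : R -> R) : (forall t, 0 < t -> f t = g t) ->
  forall m t, 0 < t -> derive1n m f t = derive1n m g t.
Proof.
move=> fg; elim=> [|m IH] t t0; first exact: fg.
rewrite !derive1nS !derive1E; apply: near_eq_derive.
by near=> s; apply: IH; near: s; exact: lt_nbhsr.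
Unshelve. all: by end_near. Qed.

Lemma derivable_eq_on_pos {R : realType} (f g : R -> R) t : (forall t, 0 < t -> f t = g t) ->
  0 < t -> derivable g t 1 -> derivable f t 1.
Proof.
move=> fg t0; apply: near_eq_derivable.
by near=> s; apply/esym/fg; near: s; exact: lt_nbhsr.
Unshelve. all: by end_near. Qed.

Theorem theorem2p5 (d : measure_display) (T : measurableType d)
    (R : realType) (P : probability T R)
    (lambda : nat -> R) (N : R -> T -> nat)
    (n : nat) (B : 'I_n -> R -> T -> R)
    (lambda_gt0 : forall k, (1 <= k)%N -> 0 < lambda k)
    (no_explosion : (\sum_(1 <= k <oo) ((lambda k)^-1)%:E = +oo)%E)
    (birthN : pure_birth_process P lambda N)
    (n_ge1 : (1 <= n)%N)
    (brownianB : forall j, standard_brownian_motion P (B j))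
    (indepBN : mutual_independence P (joint_sigma B N)) :
  let p := state_prob P (iterated_birth B N) in
  forall (k : nat) (t : R), (1 <= k)%N -> 0 < t ->
    (forall m : nat, (m < 2 ^ n)%N -> derivable (derive1n m (p k)) t 1) /\
    derive1n (2 ^ n) (p k) t =
      2 ^+ (2 ^ n - 1) * (lambda k * p k t - lambda k.-1 * p k.-1 t).
Proof.
move=> p k t k1 t0.
(* State 0 has probability 0 by definition; each further state solves a linear equation whose source
   is the preceding one. *)
have pV j : exists2 v, exppoly_span v & forall s, 0 <= s -> state_prob P N j s = v s.
  elim: j => [|j [v Vv pv]]; first by exists (fun=> 0) => //; exact: Exppoly_span0.
  have [v' [Vv' pv'] _] := birth_prob_exppoly lambda_gt0 birthN (isT : (1 <= j.+1)%N) Vv pv.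
  by exists v'.
have [v Vv pv] := pV k.-1.
have [v' [Vv' pv'] dv'] := birth_prob_exppoly lambda_gt0 birthN k1 Vv pv.
pose S s w := iterated_passage B s w.
have Sint f s : exppoly_span f -> 0 <= s -> P.-integrable setT (fun w => (f (S s w))%:E).
  move=> Vf s0; apply: integrable_exppoly_span => //.
    exact: (measurable_passage_alongT brownianB).
  by move=> w; exact: passage_along_ge0.
have ES f F s : 0 <= s -> iter_passage_transform n f F ->
    (\int[P]_w (f (S s w))%:E = (F s)%:E)%E.
  move=> s0 fF; apply: (expectation_passage_along birthN brownianB indepBN) => //.
    exact: enum_uniq.
  by rewrite size_enum_ord.
have pE j u s : 0 <= s -> exppoly_span u -> (forall s, 0 <= s -> state_prob P N j s = u s) ->
    (\int[P]_w (u (S s w))%:E = (p j s)%:E)%E.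
  move=> s0 Vu pu; case: j pu => [|j] pu.
    rewrite /p/=; apply: integral0_eq => w _.
    by rewrite -pu//; exact: passage_along_ge0.
  rewrite /p /state_prob fineK.
    by rewrite -(birth_at_passage birthN brownianB indepBN _ s0 Vu pu).
  by rewrite [X in X \is a fin_num](birth_at_passage birthN brownianB indepBN _ s0 Vu pu) integrable_fin_num//; exact: Sint.
have [F vF] := iter_passage_transform_ex n Vv'.
have VF := iter_passage_transform_span vF.
have pF s : 0 < s -> p k s = F s.
  move=> s0; apply: EFin_inj; rewrite -(pE k v' s (ltW s0) Vv' pv').
  exact: ES (ltW s0) vF.
split.
  move=> m _; apply: (derivable_eq_on_pos (g := derive1n m F)) => //.
    exact: derive1n_eq_on_pos.
  exact/exppoly_span_derivable/exppoly_span_derive1n.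
rewrite (derive1n_eq_on_pos pF)//.
have t0' := ltW t0.
(* The expectation of [derive1 v'] at the iterated time is computed twice: by the transform it is
   [passage_rate n] times the derivative of order 2^n, by the forward equation a combination of
   [p k t] and [p k.-1 t]. *)
have := ES _ _ t t0' (iter_passage_transform_derive vF).
rewrite dv'; under eq_integral do rewrite EFinD !EFinM.
rewrite integralD//; last 2 first.
- by apply: integrableZl => //; exact: Sint.
- by apply: integrableZl => //; exact: Sint.
rewrite !integralZl//; [|exact: Sint|exact: Sint].
rewrite (pE k)// (pE k.-1)// -!EFinM -EFinD passage_rateE// => -[E].
have c0 : 2 ^+ (2 ^ n - 1) != 0 :> R by rewrite expf_neq0 ?pnatr_eq0.
rewrite -[LHS](mulVKf c0); congr (_ * _).
by move: E; rewrite !mulNr => E; rewrite -[LHS]opprK -E; ring.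
Qed.
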